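(* Let $n\ge3$, $\nu\in\mathbb{S}^{n-1}$, $\eta\in\mathbb{R}$ and $\alpha=\sigma_1(\eta)$. If $\eta>\eta_1^*$, then $\mathrm{Ker}\,\mathcal{H}_{h_\nu}=V_\nu^\top$. Moreover, there exists a constant $c_0(\eta,n)>0$ such that for all $\psi\in V_\nu^\bot$, $$\langle\mathcal{H}_{h_\nu}\psi,\psi\rangle_{L^2(\mathbb{S}^{n-1})}\ge c_0(\eta,n)\,\|\psi\|^2_{L^2(\mathbb{S}^{n-1})}.$$
   Context: Let $d\mu_1^\theta=\cos^{n-2}\theta\,d\theta$ on $[0,\frac\pi2]$ and, for $\eta\in\mathbb{R}$, $$\sigma_1(\eta):=\frac{(n-1)\int_0^{\pi/2}e^{\eta\sin^2\theta}\,d\mu_1^\theta}{2\int_0^{\pi/2}e^{\eta\sin^2\theta}\sin^2\theta\cos^2\theta\,d\mu_1^\theta}.$$ The function $\sigma_1$ has a unique minimizer over $\mathbb{R}$, denoted $\eta_1^*$. For $\nu\in\mathbb{S}^{n-1}$ let $$h_\nu(m)=\frac{e^{\eta(m\cdot\nu)^2}}{\int_{\mathbb{S}^{n-1}}e^{\eta(m'\cdot\nu)^2}\,dm'},\qquad m\in\mathbb{S}^{n-1},$$ which for $\alpha=\sigma_1(\eta)$ is a critical point of the Onsager functional $\mathcal{A}[f]=\int_{\mathbb{S}^{n-1}}f\log f\,dm+\frac\alpha2\int_{\mathbb{S}^{n-1}\times\mathbb{S}^{n-1}}(1-(m\cdot m')^2)f(m)f(m')\,dm\,dm'$ on probability densities.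 Let $V=\{\phi\in L^2(\mathbb{S}^{n-1}):\int_{\mathbb{S}^{n-1}}\phi\,dm=0\}$. For $f_0=h_\nu$ and $\phi\in V$ the second variation operator is $$\mathcal{H}_{f_0}\phi=\frac{\phi}{f_0}-\alpha\int_{\mathbb{S}^{n-1}}(m\cdot m')^2\phi(m')\,dm'-\frac{1}{|\mathbb{S}^{n-1}|}\int_{\mathbb{S}^{n-1}}\Big(\frac{\phi}{f_0}-\alpha\int_{\mathbb{S}^{n-1}}(m\cdot m')^2\phi(m')\,dm'\Big)dm,$$ so that $\langle\mathcal{H}_{f_0}\phi,\phi\rangle_{L^2(\mathbb{S}^{n-1})}=\int_{\mathbb{S}^{n-1}}\frac{\phi^2}{f_0}\,dm-\alpha\int_{\mathbb{S}^{n-1}\times\mathbb{S}^{n-1}}(m\cdot m')^2\phi(m)\phi(m')\,dm\,dm'$. Put $\mathrm{Ker}\,\mathcal{H}_{h_\nu}=\{\phi\in V:\mathcal{H}_{h_\nu}\phi=0\}$, $$V_\nu^\top=\big\{u\cdot[m-\nu(m\cdot\nu)](m\cdot\nu)h_\nu(m):\ u\in\mathbb{R}^n\big\},$$ $$V_\nu^\bot=\{\psi\in V:\ \langle\psi,\phi\rangle_{L^2(\mathbb{S}^{n-1})}=0\ \text{ for all }\phi\in V_\nu^\top\}.$$ *)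

(* Defs.v *)
From HB Require Import structures.
From mathcomp Require Import all_boot all_order all_algebra.
From mathcomp Require Import all_classical all_reals all_analysis.
From mathcomp Require Import measurable_realfun.

Set Implicit Arguments.
Unset Strict Implicit.
Unset Printing Implicit Defensive.

Import Order.TTheory GRing.Theory Num.Theory.
Import numFieldNormedType.Exports.

Local Open Scope classical_set_scope.
Local Open Scope ring_scope.

(* The sigma-algebra on 'rV[R]_n is generated by the coordinate maps, exactly
   as for the library's n.-tuple R; it is the Borel sigma-algebra of R^n. *)
Section measurable_rV.
Context {R : realType}.
Variable n : nat.

Let coord (i : 'I_n) (x : 'rV[R]_n) : measurableTypeR R := x ord0 i.

Let rV_set0 : g_sigma_preimage coord set0.
Proof. exact: sigma_algebra0. Qed.

Let rV_setC A : g_sigma_preimage coord A -> g_sigma_preimage coord (~` A).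
Proof. exact: sigma_algebraC. Qed.

Let rV_bigcup (F : _^nat) : (forall i, g_sigma_preimage coord (F i)) ->
  g_sigma_preimage coord (\bigcup_i (F i)).
Proof. exact: sigma_algebra_bigcup. Qed.

HB.instance Definition _ := @isMeasurable.Build default_measure_display
  'rV[R]_n (g_sigma_preimage coord) rV_set0 rV_setC rV_bigcup.

Lemma measurable_rV_coord (i : 'I_n) :
  measurable_fun [set: 'rV[R]_n] (fun x => x ord0 i : measurableTypeR R).
Proof.
move=> _ Y mY; rewrite setTI; apply: sub_sigma_algebra => /=.
rewrite -bigcup_seq/=; exists i => /=; first by rewrite mem_index_enum.
by exists Y => //; rewrite setTI.
Qed.

Lemma measurable_fun_rVP d (T : measurableType d) (f : T -> 'rV[R]_n) :
  (forall i, measurable_fun [set: T] (fun t => f t ord0 i : measurableTypeR R)) ->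
  measurable_fun [set: T] f.
Proof.
move=> mf _ A mA; rewrite setTI.
suff : @measurable _ 'rV[R]_n `<=` [set B | measurable (f @^-1` B)] by exact.
apply: smallest_sub; first split => /=.
- by rewrite preimage_set0.
- by move=> B mB; rewrite setTD preimage_setC; exact: measurableC.
- by move=> F mF; rewrite preimage_bigcup; exact: bigcupT_measurable.
move=> B; rewrite -bigcup_seq => -[i _ [C mC <-]] /=.
by rewrite setTI; have := mf i measurableT C mC; rewrite setTI.
Qed.

End measurable_rV.

(* Lebesgue measure on R^n, as the iterated product measure. *)
Section lebesgue_rV.
Context {R : realType}.

Definition rV_cons n (p : measurableTypeR R * 'rV[R]_n) : 'rV[R]_n.+1 :=
  row_mx (const_mx (p.1 : R) : 'rV_1) p.2.

Definition rV_uncons n (x : 'rV[R]_n.+1) : measurableTypeR R * 'rV[R]_n :=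
  (x ord0 ord0, \row_(i < n) x ord0 (lift ord0 i)).

Lemma rV_consE0 n (p : measurableTypeR R * 'rV[R]_n) :
  rV_cons p ord0 ord0 = p.1.
Proof.
rewrite /rV_cons mxE; case: splitP => [j _|k /= /eqP]; last by rewrite add1n.
by rewrite mxE.
Qed.

Lemma rV_consES n (p : measurableTypeR R * 'rV[R]_n) (i : 'I_n) :
  rV_cons p ord0 (lift ord0 i) = p.2 ord0 i.
Proof.
rewrite /rV_cons mxE; case: splitP => [j /eqP|k /= /eqP].
  by rewrite ord1.
by rewrite /bump /= !add1n eqSS => /eqP /val_inj ->.
Qed.

Lemma rV_consK n : cancel (@rV_cons n) (@rV_uncons n).
Proof.
move=> [x v]; rewrite /rV_uncons rV_consE0; congr pair.
by apply/rowP => i; rewrite mxE rV_consES.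
Qed.

Lemma measurable_rV_cons n : measurable_fun setT (@rV_cons n).
Proof.
apply: measurable_fun_rVP => i; case: (unliftP ord0 i) => [j|] ->.
  apply: (eq_measurable_fun
    ((fun x : 'rV[R]_n => x ord0 j : measurableTypeR R) \o snd)).
    by move=> p _ /=; rewrite rV_consES.
  exact: (measurableT_comp (@measurable_rV_coord R n j)).
apply: (eq_measurable_fun fst) => [p _|]; last exact: measurable_fst.
by rewrite rV_consE0.
Qed.

Lemma measurable_rV_uncons n : measurable_fun setT (@rV_uncons n).
Proof.
apply: measurable_fun_pair; first exact: measurable_rV_coord.
apply: measurable_fun_rVP => i.
apply: (eq_measurable_fun
  (fun x : 'rV[R]_n.+1 => x ord0 (lift ord0 i) : measurableTypeR R)).
  by move=> x _; rewrite mxE.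
exact: measurable_rV_coord.
Qed.

Section lebesgue_rV_succ.
Variables (n : nat) (m : {sigma_finite_measure set 'rV[R]_n -> \bar R}).

Definition lebesgue_rV_succ : set 'rV[R]_n.+1 -> \bar R :=
  pushforward (lebesgue_measure \x m)%E (@rV_cons n).

Let mcons := @measurable_rV_cons n.

Let succ0 : lebesgue_rV_succ set0 = 0%E.
Proof. exact: measure0. Qed.

Let succ_ge0 A : (0 <= lebesgue_rV_succ A)%E.
Proof. exact: measure_ge0. Qed.

Let succ_sigma_additive : semi_sigma_additive lebesgue_rV_succ.
Proof. exact: measure_semi_sigma_additive. Qed.

HB.instance Definition _ := isMeasure.Build _ _ _ lebesgue_rV_succ
  succ0 succ_ge0 succ_sigma_additive.

Let sigma_finite_succ : sigma_finite setT lebesgue_rV_succ.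
Proof.
have /sigma_finiteP[F [TF ndF Foo]] := sigma_finiteT (@lebesgue_measure R).
have /sigma_finiteP[G [TG ndG Goo]] := sigma_finiteT m.
exists (fun k => @rV_uncons n @^-1` (F k `*` G k)).
  apply/esym; rewrite -preimage_bigcup -subTset => x _ /=.
  have [i _ Fi] : (\bigcup_i F i) (rV_uncons x).1 by rewrite -TF.
  have [j _ Gj] : (\bigcup_i G i) (rV_uncons x).2 by rewrite -TG.
  exists (maxn i j) => //; split.
  - by move: Fi; exact/subsetPset/ndF/leq_maxl.
  - by move: Gj; exact/subsetPset/ndG/leq_maxr.
move=> k; have [mF Fk] := Foo k; have [mG Gk] := Goo k; split.
  rewrite -[X in measurable X]setTI; apply: measurable_rV_uncons => //.
  exact: measurableX.
rewrite /lebesgue_rV_succ /pushforward -comp_preimage.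
rewrite (_ : _ \o _ = id) ?preimage_id; last first.
  by apply/funext => p /=; rewrite rV_consK.
by rewrite product_measure1E// lte_mul_pinfty// ge0_fin_numE.
Qed.

HB.instance Definition _ := Measure_isSigmaFinite.Build _ _ _ lebesgue_rV_succ
  sigma_finite_succ.

End lebesgue_rV_succ.

Fixpoint lebesgue_rV n : {sigma_finite_measure set 'rV[R]_n -> \bar R} :=
  if n is k.+1 then lebesgue_rV_succ (lebesgue_rV k) else \d_(0 : 'rV[R]_0).

End lebesgue_rV.
Arguments lebesgue_rV : clear implicits.

Section sphere.
Context {R : realType}.

Definition dot n (x y : 'rV[R]_n) : R := \sum_(i < n) x ord0 i * y ord0 i.

(* The library's norm `|x| on 'rV[R]_n is the sup norm. *)
Definition enorm n (x : 'rV[R]_n) : R := Num.sqrt (dot x x).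

Definition sphere n : set 'rV[R]_n := [set m | enorm m = 1].

Definition punctured_ball n : set 'rV[R]_n := [set x | 0 < enorm x <= 1].

Definition normalize n (x : 'rV[R]_n) : 'rV[R]_n := (enorm x)^-1 *: x.

Lemma dotxx_ge0 n (x : 'rV[R]_n) : 0 <= dot x x.
Proof. by apply: sumr_ge0 => i _; rewrite -expr2 sqr_ge0. Qed.

Lemma enorm_normalize n (x : 'rV[R]_n) : 0 < enorm x -> enorm (normalize x) = 1.
Proof.
move=> x0; rewrite {1}/enorm /normalize.
have -> : dot ((enorm x)^-1 *: x) ((enorm x)^-1 *: x) = (enorm x) ^- 2 * dot x x.
  rewrite /dot mulr_sumr; apply: eq_bigr => i _.
  by rewrite !mxE mulrACA -expr2 exprVn.
rewrite -(sqr_sqrtr (dotxx_ge0 x)) -/(enorm x) mulVf ?sqrtr1//.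
by rewrite expf_neq0// gt_eqF.
Qed.

Lemma measurable_enorm n : measurable_fun setT (@enorm n).
Proof.
apply: (eq_measurable_fun (fun x => dot x x `^ (2^-1))).
  by move=> x _; rewrite powR12_sqrt// dotxx_ge0.
apply: (measurableT_comp (measurable_powR _)).
apply: measurable_sum => i.
by apply: measurable_funM; exact: measurable_rV_coord.
Qed.

Lemma measurable_normalize n : measurable_fun setT (@normalize n).
Proof.
apply: measurable_fun_rVP => i.
apply: (eq_measurable_fun (fun x : 'rV[R]_n => enorm x `^ (-1) * x ord0 i)).
  by move=> x _; rewrite mxE powR_inv1// sqrtr_ge0.
apply: measurable_funM; last exact: measurable_rV_coord.
exact: (measurableT_comp (measurable_powR _) (@measurable_enorm n)).
Qed.

Lemma measurable_punctured_ball n : measurable (@punctured_ball n).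
Proof.
have -> : @punctured_ball n = setT `&` @enorm n @^-1` `]0, 1]%classic.
  by rewrite setTI; apply/seteqP; split => x /=; rewrite in_itv.
exact: measurable_enorm.
Qed.

Let cube n : set 'rV[R]_n := [set x | forall i, -1 <= x ord0 i <= 1].

Let cubeS n : @cube n.+1 = @rV_uncons R n @^-1` (`[-1, 1]%classic `*` @cube n).
Proof.
apply/seteqP; split => x /=.
  move=> cx; split; first by rewrite /= in_itv/=; exact: cx.
  by move=> i; rewrite mxE.
move=> [] /=; rewrite in_itv/= => x0 xS i.
case: (unliftP ord0 i) => [j|] -> //.
by have := xS j; rewrite mxE.
Qed.

Let measurable_cube n : measurable (@cube n).
Proof.
elim: n => [|n ih].
  have -> : @cube 0 = setT by apply/seteqP; split => x //= _ [].
  exact: measurableT.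
rewrite cubeS -[X in measurable X]setTI; apply: measurable_rV_uncons => //.
exact: measurableX.
Qed.

Let lebesgue_cube n : (lebesgue_rV R n (@cube n) < +oo)%E.
Proof.
elim: n => [|n ih].
  have -> : @cube 0 = setT by apply/seteqP; split => x //= _ [].
  by rewrite /= diracT ltry.
rewrite /= /lebesgue_rV_succ /pushforward cubeS -comp_preimage.
rewrite (_ : _ \o _ = id) ?preimage_id; last first.
  by apply/funext => p /=; rewrite rV_consK.
rewrite product_measure1E//; last exact: measurable_cube.
have I2 : (lebesgue_measure (`[(-1)%R, 1%R]%classic : set R) < +oo)%E.
  by rewrite lebesgue_measure_itv/=; case: ifP => _; rewrite -?EFinB ltry.
by rewrite lte_mul_pinfty ?measure_ge0 ?ge0_fin_numE ?measure_ge0.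
Qed.

Let ball_sub_cube n : @punctured_ball n `<=` @cube n.
Proof.
move=> x /= /andP[_ x1] i; rewrite -ler_norml.
apply: le_trans x1; rewrite -sqrtr_sqr ler_sqrt ?dotxx_ge0//.
rewrite /dot (bigD1 i)//= -expr2 lerDl.
by apply: sumr_ge0 => j _; rewrite -expr2 sqr_ge0.
Qed.

(* Surface measure on S^(n-1), as the cone measure of polar coordinates:
   n times the Lebesgue measure of {r m | 0 < r <= 1, m in A}.
   It is a measure on all of R^n, carried by the sphere (sphere_measureC), so
   that integrals over the whole space are integrals over the sphere, and
   functions on the sphere are functions on R^n up to sphere_measure-almost
   everywhere equality. *)
Definition sphere_measure n : set 'rV[R]_n -> \bar R := fun A =>
  (n%:R%:E * lebesgue_rV R n (@normalize n @^-1` A `&` @punctured_ball n))%E.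

Section sphere_measure_instances.
Variable n : nat.

Let ball_part :=
  pushforward (mrestr (lebesgue_rV R n) (@measurable_punctured_ball n)) (@normalize n).

Let mnormalize := @measurable_normalize n.

Let ball0 : ball_part set0 = 0%E. Proof. exact: measure0. Qed.

Let ball_ge0 A : (0 <= ball_part A)%E. Proof. exact: measure_ge0. Qed.

Let ball_sigma_additive : semi_sigma_additive ball_part.
Proof. exact: measure_semi_sigma_additive. Qed.

HB.instance Definition _ := isMeasure.Build _ _ _ ball_part
  ball0 ball_ge0 ball_sigma_additive.

Let scaled := mscale (n%:R%:nng : {nonneg R}) ball_part.

Let sphere0 : sphere_measure (@set0 'rV[R]_n) = 0%E.
Proof. exact: (measure0 scaled). Qed.

Let sphere_ge0 (A : set 'rV[R]_n) : (0 <= sphere_measure A)%E.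
Proof. exact: (measure_ge0 scaled). Qed.

Let sphere_sigma_additive : semi_sigma_additive (@sphere_measure n).
Proof. exact: (@measure_semi_sigma_additive _ _ _ scaled). Qed.

HB.instance Definition _ := isMeasure.Build _ _ _ (@sphere_measure n)
  sphere0 sphere_ge0 sphere_sigma_additive.

Let sphere_fin : fin_num_fun (@sphere_measure n).
Proof.
move=> A mA; rewrite ge0_fin_numE//; apply: lte_mul_pinfty => //.
apply: (le_lt_trans _ (@lebesgue_cube n)); apply: le_measure.
- rewrite inE; apply: measurableI; last exact: measurable_punctured_ball.
  by rewrite -[X in measurable X]setTI; exact: mnormalize.
- by rewrite inE; exact: measurable_cube.
- by move=> x [_]; exact: ball_sub_cube.
Qed.

HB.instance Definition _ := Measure_isFinite.Build _ _ _ (@sphere_measure n)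
  sphere_fin.

End sphere_measure_instances.

Lemma sphere_measureC n : sphere_measure (~` @sphere n) = 0%E.
Proof.
rewrite /sphere_measure (_ : _ `&` _ = set0) ?measure0 ?mule0//.
by apply/seteqP; split => x //= [h /andP[x0 _]]; apply: h; exact: enorm_normalize.
Qed.

End sphere.
Arguments sphere {R} n.
Arguments sphere_measure {R} n.

Section onsager.
Context {R : realType}.
Variable n : nat.

Local Notation area := (@sphere_measure R n).
Local Notation mu := (@lebesgue_measure R).

Definition sigma1 (eta : R) : R :=
  ((n%:R - 1) *
     \int[mu]_(t in `[0, pi / 2]%classic) (expR (eta * sin t ^+ 2) * cos t ^+ (n - 2))) /
  (2 * \int[mu]_(t in `[0, pi / 2]%classic)
     (expR (eta * sin t ^+ 2) * sin t ^+ 2 * cos t ^+ 2 * cos t ^+ (n - 2))).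

Definition equilibrium (eta : R) (nu m : 'rV[R]_n) : R :=
  expR (eta * dot m nu ^+ 2) / \int[area]_m' expR (eta * dot m' nu ^+ 2).

Definition uncentered_variation (alpha : R) (f0 phi : 'rV[R]_n -> R)
    (m : 'rV[R]_n) : R :=
  phi m / f0 m - alpha * \int[area]_m' (dot m m' ^+ 2 * phi m').

Definition second_variation (alpha : R) (f0 phi : 'rV[R]_n -> R)
    (m : 'rV[R]_n) : R :=
  uncentered_variation alpha f0 phi m -
  (fine (area setT))^-1 * \int[area]_m' uncentered_variation alpha f0 phi m'.

(* Elements of L^2 are represented by functions; the subsets of L^2 below are
   therefore closed under almost everywhere equality. *)
Definition mean_zero_L2 : set ('rV[R]_n -> R) :=
  [set phi | phi \in Lfun area 2%:E /\ \int[area]_m phi m = 0].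

Definition inner_L2 (phi psi : 'rV[R]_n -> R) : R := \int[area]_m (phi m * psi m).

Definition norm_L2 (phi : 'rV[R]_n -> R) : R :=
  fine ('N[area]_2%:E[EFin \o phi])%E.

Definition ker_second_variation (alpha : R) (f0 : 'rV[R]_n -> R) :
    set ('rV[R]_n -> R) :=
  [set phi | mean_zero_L2 phi /\ second_variation alpha f0 phi = cst 0 %[ae area]].

Definition tangent_space (eta : R) (nu : 'rV[R]_n) : set ('rV[R]_n -> R) :=
  [set phi | phi \in Lfun area 2%:E /\ exists u : 'rV[R]_n,
     phi = (fun m => dot u (m - dot m nu *: nu) * dot m nu * equilibrium eta nu m)
       %[ae area]].

Definition tangent_perp (eta : R) (nu : 'rV[R]_n) : set ('rV[R]_n -> R) :=
  [set psi | mean_zero_L2 psi /\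
     forall phi, tangent_space eta nu phi -> inner_L2 psi phi = 0].

End onsager.

(* Main.v *)
Require Import Defs.
From mathcomp Require Import all_boot all_order all_algebra.
From mathcomp Require Import all_classical all_reals all_analysis.
From mathcomp Require Import measurable_realfun ring lra zify.
Set Implicit Arguments.
Unset Strict Implicit.
Unset Printing Implicit Defensive.
Import Order.TTheory GRing.Theory Num.Theory.
Import numFieldNormedType.Exports.
Local Open Scope classical_set_scope.
Local Open Scope ring_scope.

(** The kernel (m . m')^2 has finite rank: in an orthonormal frame with first
    vector nu and coordinates y_i, it is the sum of the products
    y_i(m) y_j(m) y_i(m') y_j(m'). So the quadratic form of the second variation
    at phi is \int phi^2 / h - alpha |M|^2, where h is the equilibrium, M is the
    symmetric matrix of the second moments \int y_i y_j phi, and |M| its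
    Frobenius norm; M is traceless because phi has mean zero. Let s = (m . nu)^2
    and let <f> be the mean of f under h.

    By axial symmetry the covariance, under h, of the quadratic forms in m is
    diagonal on three families of matrices. The corresponding directions for phi
    are h (s - <s>) (axial), h (m . nu) (u . m) with u orthogonal to nu (mixed),
    and h times the traceless quadratic forms in the orthogonal complement of nu
    (transverse). The choice alpha = sigma1 eta makes the mixed directions, which
    are those of the tangent space, exactly neutral. The form is positive on the
    others when, in dimension n,
    - n Var s < 2 <s (1 - s)> (axial),
    - <(1 - s)^2> < (n + 1) <s (1 - s)> (transverse),
    and then a Bessel inequality for the weight 1 / h (second_moment_bessel)
    gives a lower bound by a fixed multiple of \int rho^2 / h, where rho is phi
    minus its tangent component (energy_residual). The kernel follows at once.
    For coercivity, a phi that is orthogonal to the tangent space in L^2 is not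
    longer than rho (coercivity).

    Both inequalities concern integrals in one variable. Integrating by parts
    (angular_moment_rec), the second one follows from eta > 0, and
    B = <s (1 - s)> satisfies 2 eta B = n <s> - 1. Differentiating,
    n Var s - 2 B = 2 eta B'. Differentiating again, u = B' satisfies
    2 eta u' + (n + 4) u = n (1 - 2 <s>) Var s, where <s> increases with eta and
    equals 1 / n at eta = 0. Therefore B increases on eta <= 0 and until some
    point where <s> > 1/2, and decreases afterwards (ode_unimodal). As
    sigma1 = (n - 1) / (2 B), that point is the minimizer, and past it B' < 0 and
    eta > 0 (supercritical_conditions).

    It remains to relate the sphere to one variable. Lebesgue measure, hence the
    area, is invariant under reflections (preserving_reflection), which exchange
    any two vectors of equal length. This gives the fourth moments up to the
    distribution of s, and a recursion for the moments of s that is the same as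
    for the one-variable integrals; the exponential series then identifies the
    two (sphere_angular_moment). *)

(** * Exponential moments as power series in power moments *)

Section exponential_moments.
Context d (T : measurableType d) (R : realType).
Variables (mu : {measure set T -> \bar R}) (D : set T).
Hypothesis mD : measurable D.

Lemma integrable_Rsum I (r : seq I) (F : I -> T -> R) :
  (forall i, mu.-integrable D (EFin \o F i)) ->
  mu.-integrable D (EFin \o (fun x => \sum_(i <- r) F i x)).
Proof.
move=> iF; have := @integrable_sum _ _ _ mu D mD I r xpredT _ (fun i _ => iF i).
by apply: eq_integrable => // x _; rewrite /= sumEFin.
Qed.

Lemma Rintegral_sum I (r : seq I) (F : I -> T -> R) :
  (forall i, mu.-integrable D (EFin \o F i)) ->
  \int[mu]_(x in D) (\sum_(i <- r) F i x) =
  \sum_(i <- r) \int[mu]_(x in D) F i x.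
Proof.
move=> iF; elim: r => [|i r ih].
  rewrite big_nil; under eq_Rintegral do rewrite big_nil.
  by rewrite Rintegral_cst// mul0r.
rewrite big_cons -ih; under eq_Rintegral do rewrite big_cons.
by rewrite RintegralD//; exact: integrable_Rsum.
Qed.

Variables (w s : T -> R).
Hypothesis s01 : forall x, D x -> 0 <= s x <= 1.
Hypothesis ms : measurable_fun D s.
Hypothesis iw : mu.-integrable D (EFin \o w).

Lemma moment_integrable p :
  mu.-integrable D (EFin \o (fun x => s x ^+ p * w x)).
Proof.
have mw : measurable_fun D w by apply/measurable_EFinP; exact: measurable_int iw.
apply: (le_integrable mD _ _ iw).
  apply/measurable_EFinP; apply: measurable_funM => //.
  exact: (measurableT_comp (exprn_measurable p)).
move=> x Dx /=; rewrite lee_fin normrM ler_piMl// normrX.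
have /andP[s0 s1] := s01 Dx; by rewrite ger0_norm// exprn_ile1.
Qed.

(** Dominated convergence: since 0 <= s <= 1, the partial sums of the exponential
    series of eta * s stay below expR `|eta|. Consequently two weights whose
    power moments of s are proportional have proportional exponential moments. *)
Lemma cvg_exp_moments (eta : R) :
  (fun N => \sum_(0 <= k < N)
     (eta ^+ k / k`!%:R * \int[mu]_(x in D) (s x ^+ k * w x))) @ \oo -->
  \int[mu]_(x in D) (expR (eta * s x) * w x).
Proof.
have mw : measurable_fun D w by apply/measurable_EFinP; exact: measurable_int iw.
pose F N x := \sum_(0 <= k < N) (eta ^+ k / k`!%:R * (s x ^+ k * w x)).
have iterm k : mu.-integrable D
    (EFin \o (fun x => eta ^+ k / k`!%:R * (s x ^+ k * w x))).
  have := integrableZl mD (eta ^+ k / k`!%:R) (moment_integrable k).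
  by apply: eq_integrable.
have iF N : mu.-integrable D (EFin \o F N) by exact: integrable_Rsum.
have FE N : \int[mu]_(x in D) F N x = \sum_(0 <= k < N)
     (eta ^+ k / k`!%:R * \int[mu]_(x in D) (s x ^+ k * w x)).
  rewrite /F Rintegral_sum//; apply: eq_bigr => k _.
  by rewrite RintegralZl//; exact: moment_integrable.
rewrite (_ : (fun N => _) = (fun N => \int[mu]_(x in D) F N x)); last first.
  by apply/funext => N; rewrite FE.
have FE2 N x : F N x = series (exp_coeff (eta * s x)) N * w x.
  rewrite /F /series/= /exp_coeff/= mulr_suml; apply: eq_bigr => k _.
  by rewrite exprMn; ring.
pose g x := expR `|eta| * `|w x|.
have := @dominated_cvg _ _ _ mu D mD (fun N x => (F N x)%:E)
   (fun x => (expR (eta * s x) * w x)%:E) (fun x => (g x)%:E).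
move=> /(_ (fun N => measurable_int _ (iF N))).
have cv x : D x -> (fun N => (F N x)%:E) @ \oo --> (expR (eta * s x) * w x)%:E.
  move=> Dx; apply: cvg_EFin; first exact: nearW.
  rewrite (_ : fine \o _ = (fun N => series (exp_coeff (eta * s x)) N * w x)).
    by apply: cvgM; [exact: is_cvg_series_exp_coeff|exact: cvg_cst].
  by apply/funext => N /=; rewrite FE2.
move=> /(_ cv).
have ig : mu.-integrable D (fun x => (g x)%:E).
  have := integrableZl mD (expR `|eta|) (integrable_abse iw).
  by apply: eq_integrable.
move=> /(_ (fun _ _ => erefl) ig).
have dom N x : D x -> (`|(F N x)%:E| <= (g x)%:E)%E.
  move=> Dx; rewrite /= lee_fin FE2 normrM ler_wpM2r//.
  apply: (@le_trans _ _ (series (exp_coeff `|eta|) N)).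
    rewrite /series/=; apply: (le_trans (ler_norm_sum _ _ _)); apply: ler_sum => k _.
    rewrite /exp_coeff/= normrM normrX normrM.
    rewrite ler_pM// ?exprn_ge0 ?mulr_ge0//.
      rewrite lerXn2r ?nnegrE ?mulr_ge0// ler_piMr//.
      by have /andP[s0 s1] := s01 Dx; rewrite ger0_norm.
    by rewrite ger0_norm// invr_ge0.
  rewrite /expR; apply: nondecreasing_cvgn_le; last exact: is_cvg_series_exp_coeff.
  by apply: nondecreasing_series => k _ _; exact: exp_coeff_ge0.
move=> /(_ dom) H.
apply: fine_cvg; rewrite /Rintegral fineK//.
apply: integrable_fin_num => //.
apply: (le_integrable mD _ _ ig).
  apply/measurable_EFinP; apply: measurable_funM => //.
  apply: (measurableT_comp (@measurable_expR _)).
  by apply: measurable_funM => //.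
move=> x Dx /=; rewrite lee_fin; apply: (le_trans _ (ler_norm (g x))).
rewrite normrM (ger0_norm (expR_ge0 _)) /g ler_wpM2r// ler_expR.
have /andP[s0 s1] := s01 Dx; apply: (le_trans (ler_norm _)).
by rewrite normrM ler_piMr// ger0_norm.
Qed.
End exponential_moments.

(** * Moments of the squared latitude on a meridian *)

Section angular_moment.
Context {R : realType}.
Local Notation mu := (@lebesgue_measure R).
Local Notation quarter := (`[0, pi / 2 : R]%classic).

Lemma pihalf_gt0 : 0 < pi / 2 :> R.
Proof. by rewrite divr_gt0// pi_gt0. Qed.

Lemma sin2_itv01 (t : R) : 0 <= sin t ^+ 2 <= 1.
Proof. by rewrite sqr_ge0/= -(cos2Dsin2 t) lerDr sqr_ge0. Qed.

Lemma continuous_integrable_quarter (f : R -> R) :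
  continuous f -> mu.-integrable quarter (EFin \o f).
Proof.
move=> cf; apply: continuous_compact_integrable; first exact: segment_compact.
exact: continuous_subspaceT.
Qed.

Lemma Rintegral_quarter_gt0 (f : R -> R) (t0 : R) :
  continuous f -> (forall t, 0 <= t <= pi / 2 -> 0 <= f t) ->
  0 < t0 < pi / 2 -> 0 < f t0 -> 0 < \int[mu]_(t in quarter) f t.
Proof.
move=> cf f0 /andP[t00 t0h] ft0.
have [e e0 fe] : exists2 e, 0 < e & forall t, `|t - t0| < e -> f t0 / 2 < f t.
  have := cf t0; move/cvgr_gt => /(_ (f t0 / 2)).
  have h : f t0 / 2 < f t0 by lra.
  move=> /(_ h)[e /= e0 he]; exists e => // t te; apply: he => /=.
  by rewrite distrC.
pose x := t0 - Num.min (e / 2) (t0 / 2).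
have xt0 : x < t0 by rewrite ltrBlDr ltrDl lt_min; apply/andP; split; lra.
have x0 : 0 <= x.
  rewrite subr_ge0 ge_min; apply/orP; right; lra.
have xe t : x <= t <= t0 -> `|t - t0| < e.
  move=> /andP[xt tt0]; rewrite distrC ger0_norm ?subr_ge0//.
  have : t0 - t <= Num.min (e/2) (t0/2) by rewrite /x in xt; lra.
  by rewrite le_min => /andP[]; lra.
have sub : `[x, t0]%classic `<=` quarter.
  move=> t /=; rewrite !in_itv/= => /andP[xt tt0]; apply/andP; split; lra.
have intf := continuous_integrable_quarter cf.
have intfs : mu.-integrable `[x, t0] (EFin \o f).
  by apply: integrableS intf => //.
apply: (@lt_le_trans _ _ (f t0 / 2 * (t0 - x))).
  by apply: mulr_gt0; lra.
apply: (@le_trans _ _ (\int[mu]_(t in `[x, t0]) f t)).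
  have -> : f t0 / 2 * (t0 - x) = \int[mu]_(t in `[x, t0]) (f t0 / 2).
    by rewrite Rintegral_cst//= lebesgue_measure_itv/= lte_fin xt0 -EFinD.
  apply: le_Rintegral => //=.
    apply: continuous_compact_integrable; first exact: segment_compact.
    by apply: continuous_subspaceT; exact: cst_continuous.
  move=> t /=; rewrite in_itv/= => /xe /fe; lra.
rewrite /Rintegral fine_le//; first exact: integrable_fin_num.
  exact: integrable_fin_num.
apply: ge0_subset_integral => //.
by apply/measurable_int; exact: intf.
Qed.

(** Here t is the latitude and sin t ^+ 2 plays the part of s = (m . nu)^2. Up to
    a factor independent of p and eta, these are the integrals of
    s^p e^(eta s) over the sphere (sphere_angular_moment), and differentiating
    in eta raises p by one. *)
Definition angular_moment (n p : nat) (eta : R) : R :=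
  \int[mu]_(t in quarter)
    (expR (eta * sin t ^+ 2) * (sin t ^+ 2) ^+ p * cos t ^+ (n - 2)).

Lemma continuous_weight (n : nat) (eta : R) (q : R -> R) : continuous q ->
  continuous (fun t => expR (eta * sin t ^+ 2) * q (sin t ^+ 2) * cos t ^+ (n - 2)).
Proof.
move=> cq.
have s2 : continuous (fun t : R => sin t ^+ 2).
  move=> t; apply: (@continuous_comp _ _ _ sin (fun x : R => x ^+ 2)).
    exact: continuous_sin.
  exact: exprn_continuous.
move=> t; apply: cvgM; last first.
  apply: (@continuous_comp _ _ _ cos (fun x : R => x ^+ (n - 2))).
    exact: continuous_cos.
  exact: exprn_continuous.
apply: cvgM.
  apply: (@continuous_comp _ _ _ (fun t : R => eta * sin t ^+ 2) expR).
    by apply: cvgM; [exact: cvg_cst|exact: s2].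
  exact: continuous_expR.
apply: (@continuous_comp _ _ _ (fun t : R => sin t ^+ 2) q); first exact: s2.
exact: cq.
Qed.

Lemma angular_moment_integrable n p eta :
  mu.-integrable quarter (EFin \o (fun t : R =>
    expR (eta * sin t ^+ 2) * (sin t ^+ 2) ^+ p * cos t ^+ (n - 2))).
Proof.
apply: continuous_integrable_quarter.
exact: (continuous_weight (@exprn_continuous R p)).
Qed.

(** Cubics in s cover every strict inequality below: those for s (1 - s),
    (1 - s)^2, s (1 - s)^2, and for the variance of s. *)
Lemma angular_moment_cubic_gt0 n (eta c0 c1 c2 c3 t0 : R) :
  let q s := c0 + c1 * s + c2 * s ^+ 2 + c3 * s ^+ 3 in
  (forall s, 0 <= s <= 1 -> 0 <= q s) -> 0 < t0 < pi / 2 ->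
  0 < q (sin t0 ^+ 2) ->
  0 < c0 * angular_moment n 0 eta + c1 * angular_moment n 1 eta +
      c2 * angular_moment n 2 eta + c3 * angular_moment n 3 eta.
Proof.
move=> q q0 t0h qt0.
have sin01 := sin2_itv01.
pose c := [:: c0; c1; c2; c3].
pose f p t := c`_p * (expR (eta * sin t ^+ 2) * (sin t ^+ 2) ^+ p * cos t ^+ (n - 2)).
have intf p : mu.-integrable quarter (EFin \o f p).
  apply: continuous_integrable_quarter => t; apply: cvgM; first exact: cvg_cst.
  exact: (continuous_weight (@exprn_continuous R p)).
have -> : c0 * angular_moment n 0 eta + c1 * angular_moment n 1 eta +
      c2 * angular_moment n 2 eta + c3 * angular_moment n 3 eta =
    \int[mu]_(t in quarter) (expR (eta * sin t ^+ 2) * q (sin t ^+ 2) * cos t ^+ (n - 2)).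
  transitivity (\sum_(0 <= p < 4) \int[mu]_(t in quarter) f p t).
    rewrite !big_nat_recr//= big_nil add0r.
    by rewrite !RintegralZl//; exact: angular_moment_integrable.
  rewrite -Rintegral_sum//; apply: eq_Rintegral => t _.
  by rewrite !big_nat_recr//= big_nil /f /q /=; ring.
apply: (@Rintegral_quarter_gt0 _ t0) => //.
- apply: (continuous_weight (q := q)) => x.
  apply: cvgD; [apply: cvgD; [apply: cvgD|]|]; try exact: cvg_cst;
  by apply: cvgM; [exact: cvg_cst|first [exact: cvg_id|exact: exprn_continuous]].
- move=> t /andP[t0' th]; rewrite !mulr_ge0 ?expR_ge0 ?q0//.
  by rewrite exprn_ge0// cos_ge0_pihalf// th andbT (le_trans _ t0')// oppr_le0 ltW// pihalf_gt0.
- rewrite !mulr_gt0 ?expR_gt0// exprn_gt0// cos_gt0_pihalf//.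
  move/andP: t0h => [a b]; rewrite b andbT (lt_trans _ a)// oppr_lt0 pihalf_gt0//.
Qed.

Lemma is_derive_angular_moment n p (eta : R) :
  is_derive eta 1 (angular_moment n p) (angular_moment n p.+1 eta).
Proof.
pose f (x t : R) := expR (x * sin t ^+ 2) * (sin t ^+ 2) ^+ p * cos t ^+ (n - 2).
have sin01 := sin2_itv01.
have cos01 (t : R) k : `|cos t ^+ k| <= 1.
  rewrite normrX exprn_ile1// ler_norml cos_geN1 cos_le1//.
have df (x t : R) : is_derive x 1 (f ^~ t)
    (expR (x * sin t ^+ 2) * (sin t ^+ 2) ^+ p.+1 * cos t ^+ (n - 2)).
  rewrite /f; apply: is_derive_eq.
  rewrite /GRing.scale/= [_ ^+ p.+1]exprS; ring.
have Ia : (`]eta - 1, eta + 1[%classic : set R) eta.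
  by rewrite /= in_itv/=; apply/andP; split; lra.
have intf (x : R) : (`]eta - 1, eta + 1[%classic : set R) x ->
   mu.-integrable quarter (EFin \o f x).
  by move=> _; exact: angular_moment_integrable.
have derf (x t : R) : (`]eta - 1, eta + 1[%classic : set R) x -> quarter t ->
   derivable (f ^~ t) x 1 by move=> _ _; have [] := df x t.
pose G := fun _ : R => expR (`|eta| + 1).
have G0 y : 0 <= G y by exact: expR_ge0.
have intG : mu.-integrable quarter (EFin \o G).
  by apply: continuous_integrable_quarter; exact: cst_continuous.
have Gub (x t : R) : (`]eta - 1, eta + 1[%classic : set R) x -> quarter t ->
   `|partial1of2 f x t| <= G t.
  rewrite /= in_itv/= => /andP[x1 x2] _; rewrite partial1of2E derive_val.
  rewrite normrM -[leRHS]mulr1 ler_pM// normrM -[leRHS]mulr1 ler_pM//.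
    rewrite ger0_norm ?expR_ge0// ler_expR.
    apply: (le_trans (ler_norm _)); rewrite normrM.
    have xe : `|x| <= `|eta| + 1.
      rewrite -[x](subrK eta) addrC (le_trans (ler_normD _ _))// lerD2l.
      by rewrite ler_norml; apply/andP; split; lra.
    apply: (le_trans _ xe); rewrite ler_piMr//.
    by have /andP[a b] := sin01 t; rewrite ger0_norm.
  have /andP[a b] := sin01 t.
  by rewrite normrX ger0_norm// exprn_ile1.
have mQ : measurable (quarter : set (measurableTypeR R)) by exact: measurable_itv.
apply: DeriveDef.
  exact: (derivable_under_integral mQ Ia intf derf G0 intG Gub).
rewrite -derive1E (differentiation_under_integral mQ Ia intf derf G0 intG Gub).
apply: eq_Rintegral => t _.
by rewrite partial1of2E derive_val.
Qed.

(** Integration by parts: the integrand is the derivative of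
    e^(eta sin^2 t) sin^(2k+1) t cos^(n-1) t, which vanishes at both ends. At
    eta = 0 it is a recursion that determines all power moments from the zeroth;
    for k = 0 and k = 1 it yields the two inequalities behind stability. *)
Lemma angular_moment_rec n k (eta : R) : (2 <= n)%N ->
  (2 * k%:R + 1) * angular_moment n k eta -
  (n%:R + 2 * k%:R) * angular_moment n k.+1 eta +
  2 * eta * (angular_moment n k.+1 eta - angular_moment n k.+2 eta) = 0.
Proof.
move=> n2.
pose F (t : R) := expR (eta * sin t ^+ 2) * sin t ^+ (2 * k).+1 * cos t ^+ (n - 2).+1.
pose e p (t : R) := expR (eta * sin t ^+ 2) * (sin t ^+ 2) ^+ p * cos t ^+ (n - 2).
pose f t := (2 * k%:R + 1) * e k t - (n%:R + 2 * k%:R) * e k.+1 t +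
  2 * eta * (e k.+1 t - e k.+2 t).
have ie p : mu.-integrable quarter (EFin \o e p) by exact: angular_moment_integrable.
have ce p : continuous (e p) by exact: (continuous_weight (@exprn_continuous R p)).
have dF (x : R) : is_derive x 1 F (f x).
  have dX (g : R -> R) (dg : R) m : is_derive x 1 g dg ->
      is_derive x 1 (fun t => g t ^+ m.+1) (m.+1%:R * g x ^+ m * dg).
    move=> gx; by have := is_deriveX m.+1 gx; rewrite exprfctE.
  have dE : is_derive x 1 (fun t => expR (eta * sin t ^+ 2))
      (2 * eta * sin x * cos x * expR (eta * sin x ^+ 2)).
    have ds := dX _ _ 1%N (is_derive_sin x).
    have dc := @is_derive1_comp _ expR (fun t => eta * sin t ^+ 2) x _ _ (is_derive_expR (eta * sin x ^+ 2)) (is_deriveZ eta ds).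
    by apply: (is_derive_eq dc); rewrite /GRing.scale/=; ring.
  apply: (is_derive_eq (is_deriveM (is_deriveM dE (dX _ _ (2 * k)%N (is_derive_sin x)))
    (dX _ _ (n - 2)%N (is_derive_cos x)))).
  have nE : n%:R = (n - 2)%:R + 2 :> R by rewrite natrB// subrK.
  rewrite /f /e nE /GRing.scale/=; move: (n - 2)%N => m.
  rewrite -!natr1 natrM [_ ^+ 2 ^+ k.+2]exprS [_ ^+ 2 ^+ k.+1]exprS -exprM.
  rewrite [_ ^+ (2 * k).+1]exprS [_ ^+ m.+1]exprS.
  have -> : ((fun t : R => expR (eta * sin t ^+ 2)) *
   (fun t : R => sin t ^+ (2 * k).+1)) x = expR (eta * sin x ^+ 2) * (sin x * sin x ^+ (2 * k)).
    by rewrite -exprS.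
  move: (sin x ^+ (2 * k)) (cos x ^+ m) (expR (eta * sin x ^+ 2)) => S C E.
  transitivity (E * S * C * (- (m%:R + 1) * sin x ^+ 2 + (2 * k%:R + 1) * cos x ^+ 2 +
    2 * eta * sin x ^+ 2 * cos x ^+ 2)); first ring.
  rewrite cos2sin2; ring.
have cf : continuous f.
  move=> t; apply: cvgD.
    by apply: cvgB; (apply: cvgM; [exact: cvg_cst|exact: ce]).
  by apply: cvgM; [exact: cvg_cst|apply: cvgB; exact: ce].
have cF : continuous F.
  by move=> t; apply/differentiable_continuous/derivable1_diffP; case: (dF t).
have := @continuous_FTC2 R f F 0 (pi / 2) pihalf_gt0 (continuous_subspaceT cf).
have H : derivable_oo_LRcontinuous F 0 (pi / 2).
  split => [t _||]; first by case: (dF t).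
    by apply: cvg_at_right_filter; exact: cF.
  by apply: cvg_at_left_filter; exact: cF.
move=> /(_ H); have H2 : {in `]0, pi / 2[%R, derive1 F =1 f}.
  by move=> t _; rewrite derive1E derive_val.
move=> /(_ H2); rewrite /F sin0 cos_pihalf !expr0n/= !exprS !(mul0r, mulr0) subee//.
move=> fE.
transitivity (\int[mu]_(t in quarter) f t); last by rewrite /Rintegral fE.
have mQ : measurable (quarter : set (measurableTypeR R)) by exact: measurable_itv.
have ieZ c p : mu.-integrable quarter (EFin \o (fun t => c * e p t)).
  by apply: continuous_integrable_quarter => t; apply: cvgM; [exact: cvg_cst|exact: ce].
have ieB p q : mu.-integrable quarter (EFin \o (fun t => e p t - e q t)).
  by apply: continuous_integrable_quarter => t; apply: cvgB; exact: ce.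
rewrite /f RintegralD//; last 2 first.
- apply: continuous_integrable_quarter => t.
  by apply: cvgB; (apply: cvgM; [exact: cvg_cst|exact: ce]).
- apply: continuous_integrable_quarter => t.
  by apply: cvgM; [exact: cvg_cst|apply: cvgB; exact: ce].
by rewrite RintegralB// !RintegralZl// RintegralB.
Qed.
End angular_moment.

(** * Monotonicity of sigma1 past its minimizer *)

Section unimodality.
Context {R : realType}.

Lemma is_derive_MVT (f f' : R -> R) (a b : R) :
  (forall x : R, is_derive x 1 f (f' x)) -> a < b ->
  exists2 c, a < c < b & f b - f a = f' c * (b - a).
Proof.
move=> df ab.
have cf : continuous f.
  by move=> t; apply/differentiable_continuous/derivable1_diffP; case: (df t).
have [c] := MVT ab (fun x _ => df x) (continuous_subspaceT cf).
by rewrite in_itv/= => h e; exists c.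
Qed.

(** With x = e y^2 and e = 1 or e = -1, the function y^(m+1) u(e y^2) has
    derivative c0 y^m V (1 - 2 A); the substitution avoids the half-integer
    powers of |x| that an integrating factor would need. Hence u > 0 on x <= 0,
    and on x > 0 as long as A < 1/2, so that A > 1/2 at the zero eta1. Beyond
    eta1 the same function decreases from zero. *)
Lemma ode_unimodal (m : nat) (c0 : R) (A V u u' : R -> R)
    (eta1 eta : R) : 0 < c0 ->
  (forall x : R, is_derive x 1 A (V x)) -> (forall x, 0 < V x) ->
  (forall x : R, is_derive x 1 u (u' x)) ->
  (forall x, 2 * x * u' x + m.+1%:R * u x = c0 * V x * (1 - 2 * A x)) ->
  A 0 < 2^-1 -> u eta1 = 0 -> eta1 < eta -> 0 < eta /\ u eta < 0.
Proof.
move=> c00 dA V0 du ode A0 u1 e1.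
have Ainc a b : a < b -> A a < A b.
  move=> ab; have [c _ h] := is_derive_MVT dA ab.
  by rewrite -subr_gt0 h mulr_gt0// subr_gt0.
have Phi (e y : R) : is_derive y 1 (fun y => y ^+ m.+1 * u (e * y ^+ 2))
   (y ^+ m * (2 * (e * y ^+ 2) * u' (e * y ^+ 2) + m.+1%:R * u (e * y ^+ 2))).
  have dX k : is_derive y 1 (fun y => y ^+ k.+1) (k.+1%:R * y ^+ k * 1).
    by have := is_deriveX k.+1 (is_derive_id y (1 : R)); rewrite exprfctE.
  have dc := @is_derive1_comp _ u (fun y => e * y ^+ 2) y _ _ (du _) (is_deriveZ e (dX 1%N)).
  apply: (is_derive_eq (is_deriveM (dX m) dc)).
  by rewrite /GRing.scale/= exprS; ring.
have up e y0 y1 : 0 <= y0 -> y0 < y1 ->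
    (forall y, y0 < y < y1 -> A (e * y ^+ 2) < 2^-1) ->
    y0 ^+ m.+1 * u (e * y0 ^+ 2) < y1 ^+ m.+1 * u (e * y1 ^+ 2).
  move=> y00 y01 Ah; have [c ch h] := is_derive_MVT (Phi e) y01.
  rewrite -subr_gt0 h ode !mulr_gt0// ?subr_gt0// ?exprn_gt0//.
    by case/andP: ch => yc _; exact: le_lt_trans yc.
  by have := Ah c ch; lra.
have neg x : x < 0 -> 0 < u x.
  move=> x0; have := up (-1) 0 (Num.sqrt (- x)) (lexx _).
  rewrite sqrtr_gt0 oppr_gt0 sqr_sqrtr ?oppr_ge0 ?ltW// (mulN1r (- x)) opprK => /(_ x0).
  rewrite expr0n mul0r pmulr_rgt0 ?exprn_gt0 ?sqrtr_gt0 ?oppr_gt0//; apply.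
  move=> y /andP[y0 _]; apply: lt_trans A0; apply: Ainc.
  by rewrite mulN1r oppr_lt0 exprn_gt0.
have u0 : 0 < u 0.
  have := ode 0; rewrite mulr0 mul0r add0r => h.
  rewrite -(pmulr_rgt0 _ (ltr0Sn R m)) h mulr_gt0 ?mulr_gt0//; lra.
have e10 : 0 < eta1.
  rewrite ltNge le_eqVlt; apply/negP => /orP[/eqP e|/neg]; last by rewrite u1 ltxx.
  by move: u0; rewrite -{2}e u1 ltxx.
have eta0 : 0 < eta by exact: lt_trans e1.
split=> //.
have A1 : 2^-1 < A eta1.
  rewrite ltNge; apply/negP => A1.
  have := up 1 0 (Num.sqrt eta1) (lexx _).
  rewrite sqrtr_gt0 !mul1r sqr_sqrtr ?ltW// u1 expr0n mul0r mulr0 ltxx => /(_ e10) h.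
  suff : false by []; apply: h.
  move=> y /andP[y0 ys]; apply: lt_le_trans A1; apply: Ainc.
  rewrite mul1r -[ltRHS]sqr_sqrtr ?(ltW e10)// ltr_pXn2r// nnegrE ?sqrtr_ge0//.
  by rewrite ltW.
have ss : Num.sqrt eta1 < Num.sqrt eta by rewrite ltr_sqrt.
have [c ch h] := is_derive_MVT (Phi 1) ss.
move: h; rewrite !mul1r !sqr_sqrtr ?ltW// u1 mulr0 subr0 -[c ^+ 2]mul1r ode => h.
have s0 : 0 < Num.sqrt eta by rewrite sqrtr_gt0.
suff : Num.sqrt eta ^+ m.+1 * u eta < 0 by rewrite pmulr_rlt0// exprn_gt0.
rewrite h.
rewrite pmulr_llt0 ?subr_gt0// pmulr_rlt0 ?exprn_gt0//; last first.
  by case/andP: ch => yc _; apply: le_lt_trans yc; rewrite sqrtr_ge0.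
rewrite pmulr_rlt0 ?mulr_gt0// mul1r.
have : A eta1 < A (c ^+ 2); last lra.
apply: Ainc; case/andP: ch => yc _; rewrite -[ltLHS]sqr_sqrtr ?ltW//.
rewrite ltr_pXn2r// nnegrE ?sqrtr_ge0//; apply: (le_trans _ (ltW yc)).
exact: sqrtr_ge0.
Qed.
End unimodality.

Section order_parameter.
Context {R : realType}.
Variable n : nat.
Hypothesis n3 : (3 <= n)%N.
Local Notation J := (@angular_moment R n).

Lemma cos_sin_pi4_sqr : (cos (pi / 4) : R) ^+ 2 = 2^-1 /\ (sin (pi / 4) : R) ^+ 2 = 2^-1.
Proof.
have h : (pi / 4 : R) *+ 2 = pi / 2 by field.
have := cos_pihalf R; rewrite -h cos_mulr2n => h1.
have := cos2Dsin2 (pi / 4 : R); split; lra.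
Qed.

Lemma exists_sin2_neq (a : R) : exists2 t, 0 < t < pi / 2 & 0 < (sin t ^+ 2 - a) ^+ 2.
Proof.
have pi0 := pi_gt0 R; have [c4 s4] := cos_sin_pi4_sqr.
have [->|a2] := eqVneq a 2^-1; last first.
  exists (pi / 4); first by apply/andP; split; lra.
  by rewrite s4 exprn_even_gt0//= subr_eq0 eq_sym.
(* For a = 1/2, the value at pi / 4, use pi / 8, because cos (pi / 4) <> 0. *)
exists (pi / 8); first by apply/andP; split; lra.
rewrite exprn_even_gt0//= subr_eq0; apply/eqP => h.
have e : (pi / 8 : R) *+ 2 = pi / 4 by field.
have := cos_mulr2n (pi / 8 : R); rewrite e cos2sin2 h => h2.
by move: c4; rewrite h2; lra.
Qed.

Lemma mass_gt0 eta : 0 < J 0 eta.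
Proof.
have pi0 := pi_gt0 R.
have := @angular_moment_cubic_gt0 R n eta 1 0 0 0 (pi / 4).
rewrite !mul0r !addr0 mul1r; apply => [s _||]; rewrite ?mul0r ?addr0//.
apply/andP; split; lra.
Qed.

Definition order_mean eta := J 1 eta / J 0 eta.
(** The mean of s (1 - s), to which sigma1 is inversely proportional (sigma1E). *)
Definition order_gap eta := (J 1 eta - J 2 eta) / J 0 eta.
Definition order_gap_deriv eta :=
  ((J 2 eta - J 3 eta) * J 0 eta - (J 1 eta - J 2 eta) * J 1 eta) / J 0 eta ^+ 2.
Definition order_variance eta := J 2 eta / J 0 eta - order_mean eta ^+ 2.

Lemma moment_s_onem_gt0 eta : 0 < J 1 eta - J 2 eta.
Proof.
have pi0 := pi_gt0 R.
have := @angular_moment_cubic_gt0 R n eta 0 1 (-1) 0 (pi / 4).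
rewrite !mul0r !addr0 add0r mul1r mulN1r; apply => [s /andP[s0 s1]||].
- rewrite add0r mul0r mul1r addr0; nra.
- apply/andP; split; lra.
- by rewrite cos_sin_pi4_sqr.2; lra.
Qed.

Lemma moment_s_onem2_gt0 eta : 0 < J 1 eta - 2 * J 2 eta + J 3 eta.
Proof.
have pi0 := pi_gt0 R.
have := @angular_moment_cubic_gt0 R n eta 0 1 (-2) 1 (pi / 4).
rewrite !mul0r add0r !mul1r mulNr; apply => [s /andP[s0 s1]||].
- have : 0 <= s * (1 - s) ^+ 2 by rewrite mulr_ge0// sqr_ge0.
  by congr (_ <= _); ring.
- apply/andP; split; lra.
- by rewrite cos_sin_pi4_sqr.2; lra.
Qed.

Lemma moment_onem2_gt0 eta : 0 < J 0 eta - 2 * J 1 eta + J 2 eta.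
Proof.
have pi0 := pi_gt0 R.
have := @angular_moment_cubic_gt0 R n eta 1 (-2) 1 0 (pi / 4).
rewrite !mul0r addr0 !mul1r mulNr; apply => [s /andP[s0 s1]||].
- have : 0 <= (1 - s) ^+ 2 by rewrite sqr_ge0.
  by congr (_ <= _); ring.
- apply/andP; split; lra.
- by rewrite cos_sin_pi4_sqr.2; lra.
Qed.

Lemma order_variance_gt0 eta : 0 < order_variance eta.
Proof.
have J0 := mass_gt0 eta.
set a := order_mean eta.
have [t0 t0h at0] := exists_sin2_neq a.
have := @angular_moment_cubic_gt0 R n eta (a ^+ 2) (- 2 * a) 1 0 t0.
rewrite !mul0r addr0 mul1r => h.
suff : 0 < order_variance eta * J 0 eta by rewrite pmulr_lgt0.
have aE : J 1 eta = a * J 0 eta by rewrite /a /order_mean divfK// gt_eqF.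
rewrite /order_variance mulrBl divfK ?gt_eqF//.
have -> : J 2 eta - order_mean eta ^+ 2 * J 0 eta =
  a ^+ 2 * J 0 eta + - 2 * a * J 1 eta + J 2 eta by rewrite aE -/a; ring.
apply: h => //.
- move=> s _; have := sqr_ge0 (s - a); congr (_ <= _); ring.
- by move: at0; congr (_ < _); ring.
Qed.

Lemma gap_identity eta : 2 * eta * order_gap eta = n%:R * order_mean eta - 1.
Proof.
have J0 := mass_gt0 eta.
have h := angular_moment_rec 0 eta (ltnW n3).
rewrite /order_gap /order_mean mulr0 add0r addr0 mul1r in h *.
have -> : n%:R * (J 1 eta / J 0 eta) - 1 = (n%:R * J 1 eta - J 0 eta) / J 0 eta.
  by field; rewrite gt_eqF.
by rewrite mulrA; congr (_ / _); lra.
Qed.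

Lemma variance_identity eta :
  order_variance eta = order_mean eta - order_mean eta ^+ 2 - order_gap eta.
Proof. rewrite /order_variance /order_gap /order_mean; ring. Qed.

Lemma is_derive_ratio (f g : R -> R) (x df dg : R) : g x != 0 ->
  is_derive x 1 f df -> is_derive x 1 g dg ->
  is_derive x 1 (fun y => f y / g y) ((df * g x - f x * dg) / g x ^+ 2).
Proof.
move=> gx hf hg; have hv := is_deriveV gx hg.
apply: (is_derive_eq (is_deriveM hf hv)).
by rewrite /GRing.scale/=; field.
Qed.

Lemma is_derive_moment p (x : R) : is_derive x 1 (J p) (J p.+1 x).
Proof. exact: is_derive_angular_moment. Qed.

Lemma is_derive_mean (x : R) : is_derive x 1 order_mean (order_variance x).
Proof.
have J0 := mass_gt0 x.
apply: (is_derive_eq (is_derive_ratio (lt0r_neq0 J0) (is_derive_moment 1 x) (is_derive_moment 0 x))).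
by rewrite /order_variance /order_mean; field; rewrite gt_eqF.
Qed.

Lemma is_derive_gap (x : R) : is_derive x 1 order_gap (order_gap_deriv x).
Proof.
have J0 := mass_gt0 x.
exact: (is_derive_ratio (lt0r_neq0 J0) (is_deriveB (is_derive_moment 1 x) (is_derive_moment 2 x)) (is_derive_moment 0 x)).
Qed.

Lemma derivable_gap_deriv (x : R) : derivable order_gap_deriv x 1.
Proof.
have J0 := mass_gt0 x.
have h : is_derive x 1 (fun y => J 0 y ^+ 2) (2 * J 0 x * J 1 x).
  have := is_deriveX 2 (is_derive_moment 0 x); rewrite exprfctE => h.
  by apply: (is_derive_eq h).
have g : J 0 x ^+ 2 != 0 by rewrite expf_neq0// gt_eqF.
have k := is_deriveB (is_deriveM (is_deriveB (is_derive_moment 2 x) (is_derive_moment 3 x)) (is_derive_moment 0 x))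
  (is_deriveM (is_deriveB (is_derive_moment 1 x) (is_derive_moment 2 x)) (is_derive_moment 1 x)).
by have [] := @is_derive_ratio _ (fun y => J 0 y ^+ 2) x _ _ g k h.
Qed.

(** The derivative of gap_identity. It turns the stability condition along the
    axis into the sign of eta times the derivative of the gap. *)
Lemma variance_gap (x : R) :
  2 * order_gap x + 2 * x * order_gap_deriv x = n%:R * order_variance x.
Proof.
have d1 : is_derive x 1 (fun y => 2 * y * order_gap y)
    (2 * order_gap x + 2 * x * order_gap_deriv x).
  apply: (is_derive_eq (is_deriveM (is_deriveZ 2 (is_derive_id x (1 : R))) (is_derive_gap x))).
  by rewrite /GRing.scale/= [2 *: x](_ : _ = 2 * x)//; ring.
have d2 : is_derive x 1 (fun y => n%:R * order_mean y - 1) (n%:R * order_variance x).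
  apply: (is_derive_eq (is_deriveB (is_deriveZ n%:R (is_derive_mean x)) (is_derive_cst (1 : R) x (1 : R)))).
  by rewrite subr0.
have e : (fun y => 2 * y * order_gap y) = (fun y => n%:R * order_mean y - 1).
  by apply/funext => y; exact: gap_identity.
by rewrite -(@derive_val _ _ _ _ _ _ _ d1) -(@derive_val _ _ _ _ _ _ _ d2) e.
Qed.

(** Differentiates variance_gap once more, after replacing the variance by
    mean - mean^2 - gap, whose derivative is known. *)
Lemma gap_ode (x : R) :
  2 * x * derive1 order_gap_deriv x + (n + 3).+1%:R * order_gap_deriv x =
  n%:R * order_variance x * (1 - 2 * order_mean x).
Proof.
have du : is_derive x 1 order_gap_deriv (derive1 order_gap_deriv x).
  by apply: DeriveDef; [exact: derivable_gap_deriv|rewrite derive1E].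
have d1 : is_derive x 1 (fun y => 2 * order_gap y + 2 * y * order_gap_deriv y)
    (4 * order_gap_deriv x + 2 * x * derive1 order_gap_deriv x).
  apply: (is_derive_eq (is_deriveD (is_deriveZ 2 (is_derive_gap x))
    (is_deriveM (is_deriveZ 2 (is_derive_id x (1 : R))) du))).
  by rewrite /GRing.scale/= [2 *: x](_ : _ = 2 * x)//; ring.
have dm2 : is_derive x 1 (fun y => order_mean y ^+ 2) (2 * order_mean x * order_variance x).
  by have := is_deriveX 2 (is_derive_mean x); rewrite exprfctE => h; apply: (is_derive_eq h).
have d2 : is_derive x 1 (fun y => n%:R * (order_mean y - order_mean y ^+ 2 - order_gap y))
   (n%:R * (order_variance x - 2 * order_mean x * order_variance x - order_gap_deriv x)).
  exact: (is_deriveZ n%:R (is_deriveB (is_deriveB (is_derive_mean x) dm2) (is_derive_gap x))).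
have e : (fun y => 2 * order_gap y + 2 * y * order_gap_deriv y) =
    (fun y => n%:R * (order_mean y - order_mean y ^+ 2 - order_gap y)).
  by apply/funext => y; rewrite variance_gap variance_identity.
have := @derive_val _ _ _ _ _ _ _ d1; rewrite e (@derive_val _ _ _ _ _ _ _ d2) => h.
rewrite -addnS natrD; lra.
Qed.

Lemma sigma1E eta : sigma1 n eta = (n%:R - 1) / (2 * order_gap eta).
Proof.
have mQ : measurable (`[0, pi / 2]%classic : set (measurableTypeR R)) by exact: measurable_itv.
rewrite /sigma1.
have -> : \int[lebesgue_measure]_(t in `[0%R, pi / 2]%classic)
   (expR (eta * sin t ^+ 2) * cos t ^+ (n - 2)) = J 0 eta.
  by apply: eq_Rintegral => t _; rewrite expr0 mulr1.
have -> : \int[lebesgue_measure]_(t in `[0%R, pi / 2]%classic)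
   (expR (eta * sin t ^+ 2) * sin t ^+ 2 * cos t ^+ 2 * cos t ^+ (n - 2)) = J 1 eta - J 2 eta.
  rewrite -RintegralB//; [|exact: angular_moment_integrable|exact: angular_moment_integrable].
  by apply: eq_Rintegral => t _; rewrite cos2sin2; ring.
have := moment_s_onem_gt0 eta; have := mass_gt0 eta; rewrite /order_gap => h1 h2.
by field; rewrite !gt_eqF.
Qed.

(** A minimizer of sigma1 maximizes the gap, so it is a zero of the derivative of
    the gap; past such a zero the derivative is negative by ode_unimodal, and
    variance_gap converts this sign into the inequality. *)
Lemma supercritical_conditions (eta1 eta : R) :
  (forall eta', sigma1 n eta1 <= sigma1 n eta') -> eta1 < eta ->
  0 < eta /\ n%:R * order_variance eta < 2 * order_gap eta.
Proof.
move=> min1 e1.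
have n1 : 0 < n%:R - 1 :> R by rewrite subr_gt0 ltr1n ltnW.
have gap0 x : 0 < order_gap x by rewrite divr_gt0 ?moment_s_onem_gt0 ?mass_gt0.
have gap2 x : 0 < 2 * order_gap x by exact: mulr_gt0.
have gmax x : order_gap x <= order_gap eta1.
  have := min1 x; rewrite !sigma1E ler_pM2l// lef_pV2 ?posrE ?gap2//.
  by rewrite ler_pM2l.
have u1 : order_gap_deriv eta1 = 0.
  have d0 : is_derive eta1 1 order_gap 0.
    apply: (@derive1_at_max _ _ (eta1 - 1) (eta1 + 1)); first lra.
    - by move=> t _; case: (is_derive_gap t).
    - by rewrite in_itv/=; apply/andP; split; lra.
    - by move=> t _; exact: gmax.
  by rewrite -(@derive_val _ _ _ _ _ _ _ (is_derive_gap eta1)) (@derive_val _ _ _ _ _ _ _ d0).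
have du (x : R) : is_derive x 1 order_gap_deriv (derive1 order_gap_deriv x).
  by apply: DeriveDef; [exact: derivable_gap_deriv|rewrite derive1E].
have nr0 : 0 < n%:R :> R by rewrite ltr0n (leq_trans _ n3).
have m0 : order_mean 0 < 2^-1.
  have := gap_identity 0; rewrite mulr0 mul0r => h.
  rewrite -(ltr_pM2l nr0).
  have : 3 <= n%:R :> R by rewrite ler_nat.
  lra.
have [eta0 u0] := ode_unimodal nr0 is_derive_mean order_variance_gt0 du gap_ode m0 u1 e1.
split=> //; have := variance_gap eta; nra.
Qed.
End order_parameter.

(** * Measure-preserving maps of a product *)

Definition preserving d (T : measurableType d) (R : realType)
    (mu : set T -> \bar R) (f : T -> T) :=
  measurable_fun setT f /\ forall A, measurable A -> mu (f @^-1` A) = mu A.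

Section preserving.
Context d (T : measurableType d) (R : realType).

Lemma preserving_comp (mu : set T -> \bar R) (f g : T -> T) :
  preserving mu f -> preserving mu g -> preserving mu (f \o g).
Proof.
move=> [mf pf] [mg pg]; split; first exact: measurableT_comp.
move=> A mA; rewrite comp_preimage pg ?pf//.
by rewrite -[X in measurable X]setTI; exact: mf.
Qed.

Lemma preserving_Rintegral (mu : {measure set T -> \bar R}) (f : T -> T) (g : T -> R) :
  preserving mu f -> mu.-integrable setT (EFin \o g) ->
  measurable_fun setT g ->
  mu.-integrable setT (EFin \o (g \o f)) /\
  \int[mu]_x g (f x) = \int[mu]_x g x.
Proof.
move=> [mf pf] ig mg.
have mEg : measurable_fun setT (EFin \o g) by exact/measurable_EFinP.
have E (h : T -> \bar R) : (\int[pushforward mu f]_x h x = \int[mu]_x h x)%E.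
  pose m' := measure_function_pushforward__canonical__measure_function_Measure mu mf.
  by apply: (@eq_measure_integral _ _ _ setT mu m') => A mA _; exact: pf.
have igf : mu.-integrable setT (EFin \o (g \o f)).
  apply/integrableP; split.
    by apply/measurable_EFinP; exact: measurableT_comp.
  have /integrableP[_] := ig; rewrite -E ge0_integral_pushforward//.
  exact: measurableT_comp.
split=> //; rewrite /Rintegral -[in RHS]E; congr fine.
by rewrite integral_pushforward.
Qed.

Context d' (T' : measurableType d').
Variables (m1 : {sigma_finite_measure set T -> \bar R}).
Variables (m2 : {sigma_finite_measure set T' -> \bar R}).

(** Tonelli: the slices at a fixed second component are preserved. *)
Lemma preserving_fiber1 (g : T' -> T -> T) :
  measurable_fun setT (fun p : T * T' => g p.2 p.1) ->
  (forall y, preserving m1 (g y)) ->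
  preserving (m1 \x m2)%E (fun p => (g p.2 p.1, p.2)).
Proof.
move=> mg pg; have mG : measurable_fun setT (fun p : T * T' => (g p.2 p.1, p.2)).
  by apply: measurable_fun_pair => //; exact: measurable_snd.
split=> // A mA.
have mGA : measurable ((fun p : T * T' => (g p.2 p.1, p.2)) @^-1` A).
  by rewrite -[X in measurable X]setTI; exact: mG.
have E (X : set (T * T')) : measurable X -> (m1 \x m2)%E X = (m1 \x^ m2)%E X.
  apply: product_measure_unique => //= ? ? ? ?; by rewrite product_measure2E.
rewrite !E//; apply: eq_integral => y _ /=.
rewrite -[RHS](pg y).2; last exact: measurable_ysection.
by congr (m1 _); apply/seteqP; split => x; rewrite /ysection/= !inE.
Qed.

Lemma preserving_fiber2 (g : T -> T' -> T') :
  measurable_fun setT (fun p : T * T' => g p.1 p.2) ->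
  (forall x, preserving m2 (g x)) ->
  preserving (m1 \x m2)%E (fun p => (p.1, g p.1 p.2)).
Proof.
move=> mg pg; have mG : measurable_fun setT (fun p : T * T' => (p.1, g p.1 p.2)).
  by apply: measurable_fun_pair => //; exact: measurable_fst.
split=> // A mA; apply: eq_integral => x _ /=.
rewrite -[RHS](pg x).2; last exact: measurable_xsection.
by congr (m2 _); apply/seteqP; split => y; rewrite /xsection/= !inE.
Qed.
End preserving.

(** * Invariance of Lebesgue measure and of the area under reflections *)

Section lebesgue_line.
Context {R : realType}.
Local Notation mu := (@lebesgue_measure R).

Lemma preserving_translation (c : R) :
  preserving mu (fun x : measurableTypeR R => (x + c : measurableTypeR R)).
Proof.
have mc : measurable_fun setT (fun x : measurableTypeR R => (x + c : measurableTypeR R)).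
  exact: measurable_funD.
split=> // A mA; apply/esym.
pose m' := measure_function_pushforward__canonical__measure_function_Measure
  (@lebesgue_measure R) mc.
apply: (@lebesgue_measure_unique _ m') => // _ [[a b]] _ <-.
rewrite /m'/= /pushforward/=.
rewrite (_ : _ @^-1` _ = `]a - c, b - c]%classic); last first.
  apply/seteqP; split => x /=; rewrite !in_itv/= => /andP[? ?]; apply/andP; split; lra.
rewrite !lebesgue_measure_itv/= !lte_fin ltrD2r.
by rewrite -!EFinD; case: ifP => // _; congr (_%:E); lra.
Qed.

Lemma preserving_opp :
  preserving mu (fun x : measurableTypeR R => (- x : measurableTypeR R)).
Proof.
split; first exact: oppr_measurable.
by move=> A mA; exact: lebesgue_measureN.
Qed.
End lebesgue_line.

Section lebesgue_rV_invariance.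
Context {R : realType}.

Lemma preserving_rV_cons n (g : measurableTypeR R * 'rV[R]_n -> measurableTypeR R * 'rV[R]_n) :
  preserving (@lebesgue_measure R \x lebesgue_rV R n)%E g ->
  preserving (lebesgue_rV R n.+1) (@rV_cons R n \o g \o @rV_uncons R n).
Proof.
move=> [mg pg]; split.
  apply: measurableT_comp; last exact: measurable_rV_uncons.
  by apply: measurableT_comp => //; exact: measurable_rV_cons.
move=> A mA; rewrite /= /lebesgue_rV_succ /pushforward.
rewrite -[RHS]pg; last first.
  by rewrite -[X in measurable X]setTI; exact: measurable_rV_cons.
have -> // : @rV_cons R n @^-1` ((@rV_cons R n \o g \o @rV_uncons R n) @^-1` A) =
  g @^-1` (@rV_cons R n @^-1` A).
by apply/seteqP; split => p /=; rewrite rV_consK.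
Qed.

Lemma measurable_coord d (T : measurableType d) m (f : T -> 'rV[R]_m) i :
  measurable_fun setT f -> measurable_fun setT (fun x => f x ord0 i).
Proof. by move=> mf; exact: (measurableT_comp (measurable_rV_coord i)). Qed.

Lemma measurable_dot d (T : measurableType d) m (f g : T -> 'rV[R]_m) :
  measurable_fun setT f -> measurable_fun setT g ->
  measurable_fun setT (fun x => dot (f x) (g x)).
Proof.
move=> mf mg; apply: measurable_sum => i.
by apply: measurable_funM; exact: measurable_coord.
Qed.

Lemma preserving_rV_translation n (w : 'rV[R]_n) :
  preserving (lebesgue_rV R n) (fun x => x + w).
Proof.
elim: n w => [|n ih] w.
  have -> : (fun x => x + w) = idfun by apply/funext => x; apply/rowP => -[].
  by split; [exact: measurable_id|move=> A mA].
have h1 := @preserving_fiber1 _ _ _ _ _ (@lebesgue_measure R) (lebesgue_rV R n)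
  (fun _ x => x + w ord0 ord0)
  (measurable_funD measurable_fst (measurable_cst _))
  (fun _ => preserving_translation (w ord0 ord0)).
have h2 := @preserving_fiber2 _ _ _ _ _ (@lebesgue_measure R) (lebesgue_rV R n)
  (fun _ r => r + (rV_uncons w).2).
have m2 : measurable_fun setT (fun p : measurableTypeR R * 'rV[R]_n => p.2 + (rV_uncons w).2).
  apply: measurable_fun_rVP => i; under eq_fun do rewrite mxE.
  by apply: measurable_funD => //; apply: measurable_coord; exact: measurable_snd.
have := preserving_rV_cons (preserving_comp h1 (h2 m2 (fun _ => ih _))).
congr (preserving _ _); apply/funext => x /=.
by apply/rowP => i; case: (unliftP ord0 i) => [j|] ->; rewrite ?rV_consES ?rV_consE0 !mxE.
Qed.
End lebesgue_rV_invariance.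

Section reflection.
Context {R : realType}.

Lemma dotC n (x y : 'rV[R]_n) : dot x y = dot y x.
Proof. by apply: eq_bigr => i _; rewrite mulrC. Qed.

Lemma dotDl n (x y z : 'rV[R]_n) : dot (x + y) z = dot x z + dot y z.
Proof. by rewrite /dot -big_split/=; apply: eq_bigr => i _; rewrite mxE mulrDl. Qed.

Lemma dotZl n a (x z : 'rV[R]_n) : dot (a *: x) z = a * dot x z.
Proof. by rewrite /dot mulr_sumr; apply: eq_bigr => i _; rewrite mxE mulrA. Qed.

Lemma dotBl n (x y z : 'rV[R]_n) : dot (x - y) z = dot x z - dot y z.
Proof. by rewrite dotDl -scaleN1r dotZl mulN1r. Qed.

Lemma dotDr n (x y z : 'rV[R]_n) : dot z (x + y) = dot z x + dot z y.
Proof. by rewrite dotC dotDl !(dotC _ z). Qed.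

Lemma dotZr n a (x z : 'rV[R]_n) : dot z (a *: x) = a * dot z x.
Proof. by rewrite dotC dotZl (dotC _ z). Qed.

Lemma dotBr n (x y z : 'rV[R]_n) : dot z (x - y) = dot z x - dot z y.
Proof. by rewrite dotC dotBl !(dotC _ z). Qed.

Lemma dotxx_eq0 n (x : 'rV[R]_n) : (dot x x == 0) = (x == 0).
Proof.
apply/eqP/eqP => [h|->]; last by rewrite /dot big1// => i _; rewrite mxE mul0r.
apply/rowP => i; rewrite mxE; apply/eqP; rewrite -sqrf_eq0 expr2.
have /psumr_eq0P : forall i : 'I_n, true -> 0 <= x ord0 i * x ord0 i.
  by move=> j _; rewrite -expr2 sqr_ge0.
by move=> /(_ h i isT) ->.
Qed.

Lemma dot_uncons n (x y : 'rV[R]_n.+1) :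
  dot x y = x ord0 ord0 * y ord0 ord0 + dot (rV_uncons x).2 (rV_uncons y).2.
Proof.
by rewrite /dot big_ord_recl; congr (_ + _); apply: eq_bigr => i _; rewrite !mxE.
Qed.

(** The Householder reflection. At v = 0 it is the identity, because of the
    division by zero, so that reflection_swap needs no hypothesis a <> b. *)
Definition reflection n (v x : 'rV[R]_n) : 'rV[R]_n :=
  x - (2 * dot x v / dot v v) *: v.

Lemma reflection_isometry n (v x y : 'rV[R]_n) :
  dot (reflection v x) (reflection v y) = dot x y.
Proof.
rewrite /reflection; have [v0|v0] := eqVneq (dot v v) 0.
  by rewrite v0 invr0 !mulr0 !scale0r !subr0.
by rewrite !(dotBl, dotBr, dotZl, dotZr) (dotC v y); field.
Qed.

Lemma reflectionK n (v : 'rV[R]_n) : involutive (reflection v).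
Proof.
move=> x; rewrite /reflection; have [v0|v0] := eqVneq (dot v v) 0.
  by rewrite v0 invr0 !mulr0 !scale0r !subr0.
rewrite dotBl dotZl.
have -> : 2 * (dot x v - 2 * dot x v / dot v v * dot v v) / dot v v =
  - (2 * dot x v / dot v v) by field.
by rewrite scaleNr opprK subrK.
Qed.

Lemma reflection_sym n (v x y : 'rV[R]_n) :
  dot (reflection v x) y = dot x (reflection v y).
Proof. by rewrite -{1}(reflectionK v y) reflection_isometry. Qed.

(** Vectors of equal length are exchanged by a reflection: this replaces the
    choice of a rotation everywhere below. *)
Lemma reflection_swap n (a b : 'rV[R]_n) : dot a a = dot b b ->
  reflection (a - b) a = b.
Proof.
move=> ab; rewrite /reflection.
have h : dot (a - b) (a - b) = 2 * dot a (a - b).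
  by rewrite !(dotBl, dotBr) -ab (dotC b a); ring.
have [v0|v0] := eqVneq (dot (a - b) (a - b)) 0.
  have /eqP := v0; rewrite dotxx_eq0 subr_eq0 => /eqP ->.
  by rewrite subrr scaler0 subr0.
by rewrite h divff -?h// scale1r opprB addrC subrK.
Qed.

Lemma reflectionZ n (v x : 'rV[R]_n) a : reflection v (a *: x) = a *: reflection v x.
Proof. by rewrite /reflection dotZl scalerBr scalerA; congr (_ - _ *: _); ring. Qed.

Lemma measurable_reflection n (v : 'rV[R]_n) : measurable_fun setT (reflection v).
Proof.
apply: measurable_fun_rVP => i; under eq_fun do rewrite !mxE.
apply: measurable_funB; first exact: measurable_rV_coord.
apply: measurable_funM => //; apply: measurable_funM => //; apply: measurable_funM => //.
apply: measurable_dot => //; exact: measurable_id.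
Qed.

Lemma preserving_shear n (c : R) (w : 'rV[R]_n) :
  preserving (@lebesgue_measure R \x lebesgue_rV R n)%E
    (fun p => (p.1 + c * dot p.2 w : measurableTypeR R, p.2)).
Proof.
have ms : measurable_fun setT (fun p : measurableTypeR R * 'rV[R]_n =>
    (p.1 + c * dot p.2 w : measurableTypeR R)).
  apply: measurable_funD; first exact: measurable_fst.
  apply: measurable_funM => //; apply: measurable_dot => //; exact: measurable_snd.
exact: (@preserving_fiber1 _ _ _ _ _ (@lebesgue_measure R) (lebesgue_rV R n)
  (fun r x => x + c * dot r w) ms (fun r => preserving_translation (c * dot r w))).
Qed.

(** Let v = (v0, w). If v0 <> 0, take p = (x . v) / v0 as a coordinate instead of
    the first entry x0 of x = (x0, r): the reflection becomes
    (p, r) |-> (-p, r - (2 v0 p / v . v) w), a flip followed by a translation of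
    r that depends on p, and the change of coordinate is a shear. If v0 = 0 the
    reflection acts on r only, and the induction hypothesis applies. *)
Lemma preserving_reflection n (v : 'rV[R]_n) :
  preserving (lebesgue_rV R n) (reflection v).
Proof.
elim: n v => [|n ih] v.
  have -> : reflection v = idfun by apply/funext => x; apply/rowP => -[].
  by split; [exact: measurable_id|move=> A mA].
set v0 := v ord0 ord0; set w := (rV_uncons v).2.
have [v00|v00] := eqVneq v0 0.
  have mw : measurable_fun setT (fun p : measurableTypeR R * 'rV[R]_n => reflection w p.2).
    by apply: measurableT_comp; [exact: measurable_reflection|exact: measurable_snd].
  have := preserving_rV_cons (@preserving_fiber2 _ _ _ _ _ (@lebesgue_measure R)
    (lebesgue_rV R n) (fun _ => reflection w) mw (fun _ => ih w)).
  congr (preserving _ _); apply/funext => x /=; apply/rowP => i.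
  rewrite /reflection !dot_uncons -/v0 -/w v00 !mulr0 !add0r.
  case: (unliftP ord0 i) => [j|] ->; rewrite ?rV_consES ?rV_consE0 !mxE//.
  by rewrite -/v0 v00 mulr0 subr0.
have N0 : dot v v != 0.
  rewrite dotxx_eq0; apply: contra_neq v00 => v0E; by rewrite /v0 v0E mxE.
pose k := - (2 * v0 / dot v v).
pose S c := fun p : measurableTypeR R * 'rV[R]_n => (p.1 + c * dot p.2 w : measurableTypeR R, p.2).
have flip := @preserving_fiber1 _ _ _ _ _ (@lebesgue_measure R) (lebesgue_rV R n)
  (fun _ x => - x) (measurable_funN measurable_fst) (fun _ => preserving_opp).
have mt : measurable_fun setT (fun p : measurableTypeR R * 'rV[R]_n => p.2 + ((p.1 : R) * k) *: w).
  apply: measurable_fun_rVP => i; under eq_fun do rewrite !mxE.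
  apply: measurable_funD; first by apply: measurable_coord; exact: measurable_snd.
  apply: measurable_funM => //; apply: measurable_funM => //; exact: measurable_fst.
have tr := @preserving_fiber2 _ _ _ _ _ (@lebesgue_measure R) (lebesgue_rV R n)
  (fun x r => r + ((x : R) * k) *: w) mt (fun x => preserving_rV_translation _).
have := preserving_rV_cons (preserving_comp (preserving_shear (- v0^-1) w)
   (preserving_comp flip (preserving_comp tr (preserving_shear v0^-1 w)))).
congr (preserving _ _); apply/funext => x /=; apply/rowP => i.
have Nw : dot w w = dot v v - v0 ^+ 2.
  by rewrite (dot_uncons v) -/w -/v0; ring.
have xv : dot x v = x ord0 ord0 * v0 + dot (rV_uncons x).2 w by rewrite dot_uncons.
case: (unliftP ord0 i) => [j|] ->; rewrite ?rV_consES ?rV_consE0 /reflection !mxE /k xv.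
  by field; rewrite v00 N0.
rewrite -/v0 dotDl dotZl Nw /=; by field; rewrite v00 N0.
Qed.

Lemma enorm_reflection n (v x : 'rV[R]_n) : enorm (reflection v x) = enorm x.
Proof. by rewrite /enorm reflection_isometry. Qed.

(** A linear isometry commutes with the radial projection and preserves the
    punctured ball. *)
Lemma preserving_sphere_reflection n (v : 'rV[R]_n) :
  preserving (@sphere_measure R n) (reflection v).
Proof.
split; first exact: measurable_reflection.
move=> A mA; rewrite /sphere_measure; congr (_ * _)%E.
rewrite -[RHS](preserving_reflection v).2; last first.
  apply: measurableI; last exact: measurable_punctured_ball.
  by rewrite -[X in measurable X]setTI; exact: measurable_normalize.
have -> // : @normalize R n @^-1` (reflection v @^-1` A) `&` @punctured_ball R n =
  reflection v @^-1` (@normalize R n @^-1` A `&` @punctured_ball R n).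
apply/seteqP; split => x /=;
  by rewrite /punctured_ball/= /normalize !enorm_reflection reflectionZ.
Qed.
End reflection.

(** * Bounded and integrable functions on the sphere *)

Section sphere_bounded.
Context {R : realType} {n : nat}.
Local Notation area := (@sphere_measure R n).
Implicit Types f g : 'rV[R]_n -> R.

(** The bound is required on the sphere only: coordinates are unbounded on the
    whole space, on which the integrals are taken. *)
Definition sphere_bounded f := measurable_fun setT f /\
  exists M, forall m, sphere n m -> `|f m| <= M.

Definition sphere_integrable f := area.-integrable setT (EFin \o f).

Lemma measurable_sphere : measurable (@sphere R n).
Proof.
have -> : @sphere R n = setT `&` @enorm R n @^-1` [set 1] by rewrite setTI.
exact: measurable_enorm.
Qed.

Lemma sphere_coord_le1 m i : sphere n m -> `|(m : 'rV[R]_n) ord0 i| <= 1.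
Proof.
rewrite /sphere/= => m1; rewrite -m1 -sqrtr_sqr ler_sqrt ?dotxx_ge0//.
rewrite /dot (bigD1 i)//= -expr2 lerDl.
by apply: sumr_ge0 => j _; rewrite -expr2 sqr_ge0.
Qed.

Lemma sphere_dotxx (m : 'rV[R]_n) : sphere n m -> dot m m = 1.
Proof.
by rewrite /sphere/= => m1; rewrite -(sqr_sqrtr (dotxx_ge0 m)) -/(enorm m) m1 expr1n.
Qed.

Lemma bounded_cst c : sphere_bounded (fun=> c).
Proof. by split; [exact: measurable_cst|exists `|c|]. Qed.

Lemma bounded_coord i : sphere_bounded (fun m => m ord0 i).
Proof. by split; [exact: measurable_rV_coord|exists 1 => m; exact: sphere_coord_le1]. Qed.

Lemma boundedD f g : sphere_bounded f -> sphere_bounded g ->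
  sphere_bounded (fun m => f m + g m).
Proof.
move=> [mf [M fM]] [mg [N gN]]; split; first exact: measurable_funD.
by exists (M + N) => m Sm; apply: le_trans (ler_normD _ _) _; rewrite lerD ?fM ?gN.
Qed.

Lemma boundedM f g : sphere_bounded f -> sphere_bounded g ->
  sphere_bounded (fun m => f m * g m).
Proof.
move=> [mf [M fM]] [mg [N gN]]; split; first exact: measurable_funM.
by exists (M * N) => m Sm; rewrite normrM ler_pM ?fM ?gN.
Qed.

Lemma boundedN f : sphere_bounded f -> sphere_bounded (fun m => - f m).
Proof.
move=> [mf [M fM]]; split; first exact: measurable_funN.
by exists M => m Sm; rewrite normrN fM.
Qed.

Lemma boundedB f g : sphere_bounded f -> sphere_bounded g ->
  sphere_bounded (fun m => f m - g m).
Proof. by move=> bf bg; apply: boundedD => //; exact: boundedN. Qed.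

Lemma boundedX k f : sphere_bounded f -> sphere_bounded (fun m => f m ^+ k).
Proof.
move=> [mf [M fM]]; split; first exact: measurable_funX.
exists (M ^+ k) => m Sm; rewrite normrX lerXn2r ?nnegrE ?fM//.
exact: le_trans (fM _ Sm).
Qed.

Lemma bounded_expR f : sphere_bounded f -> sphere_bounded (fun m => expR (f m)).
Proof.
move=> [mf [M fM]]; split.
  exact: (measurableT_comp (@measurable_expR R)).
exists (expR M) => m Sm; rewrite ger0_norm ?expR_ge0// ler_expR.
exact: le_trans (ler_norm _) (fM _ Sm).
Qed.

Lemma bounded_sum I (r : seq I) (P : pred I) (F : I -> 'rV[R]_n -> R) :
  (forall i, sphere_bounded (F i)) ->
  sphere_bounded (fun m => \sum_(i <- r | P i) F i m).
Proof.
move=> bF; elim: r => [|i r ih].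
  by under eq_fun do rewrite big_nil; exact: bounded_cst.
under eq_fun do rewrite big_cons.
by case: (P i) => //; exact: boundedD.
Qed.

Lemma bounded_dot (a : 'rV[R]_n) : sphere_bounded (fun m => dot m a).
Proof.
apply: bounded_sum => i; apply: boundedM; [exact: bounded_coord|exact: bounded_cst].
Qed.

Lemma bounded_reflection (v : 'rV[R]_n) f :
  sphere_bounded f -> sphere_bounded (fun m => f (reflection v m)).
Proof.
move=> [mf [M fM]]; split.
  by apply: measurableT_comp => //; exact: measurable_reflection.
by exists M => m Sm; apply: fM; rewrite /sphere/= enorm_reflection.
Qed.

Lemma integrable_measurable f : sphere_integrable f -> measurable_fun setT f.
Proof. by move=> /measurable_int/measurable_EFinP. Qed.

Lemma sphere_integrableP f : measurable_fun setT f ->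
  sphere_integrable f <-> area.-integrable (sphere n) (EFin \o f).
Proof.
move=> mf; rewrite /sphere_integrable.
have -> : @sphere R n = setT `\` (~` @sphere R n) by rewrite setTD setCK.
apply: (negligible_integrable (mu := area)).
- exact: measurableC measurable_sphere.
- exact: measurableT.
- exact/measurable_EFinP.
- exact: sphere_measureC.
Qed.

Lemma integrable_bounded_mul f g : sphere_bounded f -> sphere_integrable g ->
  sphere_integrable (fun m => f m * g m).
Proof.
move=> [mf [M fM]] ig; have mg := integrable_measurable ig.
apply/sphere_integrableP; first exact: measurable_funM.
have /(sphere_integrableP mg) igS := ig.
have mS := measurable_sphere.
have iM := integrableZl mS M (integrable_abse igS).
apply: (le_integrable mS _ _ iM).
  by apply/measurable_EFinP; apply: measurable_funTS; exact: measurable_funM.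
move=> m Sm; rewrite /= lee_fin normrM normrM normr_id ler_wpM2r//.
exact: le_trans (fM _ Sm) (ler_norm _).
Qed.

Lemma integrable_cst (c : R) : sphere_integrable (fun=> c).
Proof. exact: finite_measure_integrable_cst. Qed.

Lemma integrable_bounded f : sphere_bounded f -> sphere_integrable f.
Proof.
move=> bf; have := integrable_bounded_mul bf (integrable_cst 1).
by rewrite /sphere_integrable; under eq_fun do rewrite mulr1.
Qed.

Lemma integrable_add f g : sphere_integrable f -> sphere_integrable g ->
  sphere_integrable (fun m => f m + g m).
Proof. by move=> hf hg; have := integrableD measurableT hf hg; apply: eq_integrable. Qed.

Lemma integrable_sub f g : sphere_integrable f -> sphere_integrable g ->
  sphere_integrable (fun m => f m - g m).
Proof. by move=> hf hg; have := integrableB measurableT hf hg; apply: eq_integrable. Qed.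

Lemma Rintegral_sphere f : sphere_integrable f ->
  \int[area]_m f m = \int[area]_(m in sphere n) f m.
Proof.
move=> hf; rewrite /Rintegral.
rewrite (@negligible_integral _ _ _ area setT (~` @sphere R n))//.
- by rewrite setTD setCK.
- exact: measurableC measurable_sphere.
- exact: sphere_measureC.
Qed.

Lemma eq_sphere_Rintegral f g : measurable_fun setT f -> measurable_fun setT g ->
  (forall m, sphere n m -> f m = g m) ->
  \int[area]_m f m = \int[area]_m g m.
Proof.
move=> mf mg fg; congr fine; apply: ae_eq_integral => //; try exact/measurable_EFinP.
exists (~` @sphere R n); split.
- exact: measurableC measurable_sphere.
- exact: sphere_measureC.
- by move=> m /= h Sm; apply: h => _; rewrite fg.
Qed.

Lemma Rintegral_reflection (v : 'rV[R]_n) f : sphere_bounded f ->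
  \int[area]_m f (reflection v m) = \int[area]_m f m.
Proof.
move=> bf; have [mf _] := bf.
by have [] := preserving_Rintegral (preserving_sphere_reflection v) (integrable_bounded bf) mf.
Qed.

End sphere_bounded.

(** * Distribution of the squared latitude on the sphere *)

Section sphere_moments.
Context {R : realType}.
Variable n : nat.
Local Notation area := (@sphere_measure R n.+1).
Local Notation e i := (delta_mx ord0 i : 'rV[R]_n.+1).

Lemma dot_delta (x : 'rV[R]_n.+1) i : dot x (e i) = x ord0 i.
Proof.
rewrite /dot (bigD1 i)//= mxE !eqxx mulr1 big1 ?addr0// => j ji.
by rewrite mxE eqxx (negbTE ji) mulr0.
Qed.

Lemma reflection_swapC (a b : 'rV[R]_n.+1) : dot a a = dot b b ->
  reflection (a - b) b = a.
Proof. by move=> ab; rewrite -{2}(reflection_swap ab) reflectionK. Qed.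

(** The reflection exchanging a and b fixes the first axis when a and b have the
    same component along it. *)
Lemma Rintegral_cap (F G : R -> R) (a b : 'rV[R]_n.+1) :
  dot a a = dot b b -> dot a (e ord0) = dot b (e ord0) ->
  sphere_bounded (fun m : 'rV[R]_n.+1 => F (m ord0 ord0)) ->
  sphere_bounded (fun m : 'rV[R]_n.+1 => G (dot m b)) ->
  \int[area]_m (F (m ord0 ord0) * G (dot m a)) =
  \int[area]_m (F (m ord0 ord0) * G (dot m b)).
Proof.
move=> ab a0 bF bG.
rewrite -[RHS](Rintegral_reflection (a - b)); last exact: boundedM.
apply: eq_Rintegral => m _.
rewrite -!dot_delta !reflection_sym reflection_swapC//.
rewrite (_ : reflection _ (e ord0) = e ord0)//.
by rewrite /reflection dotBr !(dotC (e ord0)) a0 subrr mulr0 mul0r scale0r subr0.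
Qed.

Lemma Rintegral_plane (G : R -> R) (a b : 'rV[R]_n.+1) : dot a a = dot b b ->
  sphere_bounded (fun m : 'rV[R]_n.+1 => G (dot m b)) ->
  \int[area]_m G (dot m a) = \int[area]_m G (dot m b).
Proof.
move=> ab bG; rewrite -[RHS](Rintegral_reflection (a - b))//.
by apply: eq_Rintegral => m _; rewrite reflection_sym reflection_swapC.
Qed.

Lemma dot_delta2 i j : dot (e i) (e j) = (i == j)%:R.
Proof. by rewrite dot_delta mxE eqxx eq_sym. Qed.

Lemma poly_ext (p q : {poly R}) : (forall x, p.[x] = q.[x]) -> p = q.
Proof.
move=> pq; apply/eqP; rewrite -subr_eq0; apply/negPn/negP => pq0.
pose s := [seq i%:R : R | i <- iota 0 (size (p - q))].
have us : uniq s by rewrite map_inj_uniq ?iota_uniq// => i j /eqP; rewrite eqr_nat => /eqP.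
have rs : all (root (p - q)) s.
  by apply/allP => x _; rewrite /root hornerD hornerN pq subrr.
by have := max_poly_roots pq0 rs us; rewrite size_map size_iota ltnn.
Qed.

(** The vectors e_0 + x e_i and sqrt (1 + x^2) e_0 have the same length, so the
    integrals of the powers of order 2k+2 of the corresponding linear forms
    agree for every real x. Both are polynomials in x; this compares their
    coefficients of x^2. *)
Lemma moment_rotation k (i : 'I_n.+1) : i != ord0 ->
  (2 * k%:R + 1) * \int[area]_m (m ord0 ord0 ^+ (2 * k) * m ord0 i ^+ 2) =
  \int[area]_m (m ord0 ord0 ^+ (2 * k.+1)).
Proof.
move=> i0.
pose c j := \int[area]_m (m ord0 ord0 ^+ (2 * k.+1 - j) * m ord0 i ^+ j).
pose P := \poly_(j < (2 * k.+1).+1) (c j *+ 'C(2 * k.+1, j)).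
pose Q : {poly R} := (c 0%N)%:P * (1 + 'X ^+ 2) ^+ k.+1.
have bc j l : sphere_bounded (fun m : 'rV[R]_n.+1 => m ord0 ord0 ^+ l * m ord0 i ^+ j).
  by apply: boundedM; apply: boundedX; exact: bounded_coord.
have PQ : P = Q.
  apply: poly_ext => x.
  rewrite /P /Q horner_poly !hornerE.
  pose b := Num.sqrt (1 + x ^+ 2) *: e ord0.
  pose a := e ord0 + x *: e i.
  have x0 : 0 <= 1 + x ^+ 2 by rewrite addr_ge0// sqr_ge0.
  have ab : dot a a = dot b b.
    rewrite /a /b !(dotDl, dotDr, dotZl, dotZr) !dot_delta2 !eqxx (negbTE i0).
    by rewrite eq_sym (negbTE i0) !(mulr0, addr0, mulr1, add0r) -!expr2 sqr_sqrtr.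
  have := @Rintegral_plane (fun t => t ^+ (2 * k.+1)) a b ab.
  move=> /(_ (boundedX _ (bounded_dot _))).
  have -> : \int[area]_m (dot m b ^+ (2 * k.+1)) = c 0%N * (1 + x ^+ 2) ^+ k.+1.
    rewrite /c subn0 -RintegralZr//; last exact: integrable_bounded.
    apply: eq_Rintegral => m _; rewrite /b dotZr dot_delta exprMn [X in X * _ = _]exprM.
    by rewrite sqr_sqrtr// expr0 mulr1 mulrC.
  move=> <-.
  rewrite -(big_mkord xpredT (fun j => c j *+ 'C(2 * k.+1, j) * x ^+ j)).
  transitivity (\sum_(0 <= j < (2 * k.+1).+1) \int[area]_m
    ((x ^+ j *+ 'C(2 * k.+1, j)) * (m ord0 ord0 ^+ (2 * k.+1 - j) * m ord0 i ^+ j))).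
    apply: eq_bigr => j _; rewrite RintegralZl//; last exact: integrable_bounded.
    by rewrite -/(c j) mulrnAl mulrnAl mulrC.
  rewrite -Rintegral_sum//; last first.
    move=> j; apply: integrable_bounded; apply: boundedM => //; exact: bounded_cst.
  apply: eq_Rintegral => m _; rewrite /a dotDr dotZr !dot_delta exprDn big_mkord.
  apply: eq_bigr => j _; rewrite exprMn mulrnAl; congr (_ *+ _); ring.
have := congr1 (fun p : {poly R} => p`_2) PQ.
rewrite /P /Q coef_poly coefCM (_ : (2 < (2 * k.+1).+1)%N = true); last by lia.
rewrite (addrC 1) exprDn coef_sum.
rewrite (bigD1 (inord k : 'I_k.+2))//= big1 ?addr0; last first.
  move=> j jk; rewrite expr1n mulr1 -exprM coefMn coefXn.
  case: eqP => [h|]; last by rewrite mul0rn.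
  case/eqP : jk; apply: val_inj; rewrite /= inordK//.
  have := ltn_ord j; lia.
rewrite inordK// expr1n mulr1 subSnn -exprM muln1 coefMn coefXn eqxx/=.
rewrite binSn.
have -> : 'C(2 * k.+1, 2) = (k.+1 * (2 * k + 1))%N.
  by rewrite bin2; rewrite (_ : (2 * k.+1).-1 = (2 * k + 1)%N); [rewrite -mulnA mul2n doubleK|lia].
rewrite /c subn0 (_ : (2 * k.+1 - 2 = 2 * k)%N); last lia.
under [in RHS]eq_Rintegral do rewrite expr0 mulr1.
rewrite -[X in X = _ -> _]mulr_natr natrM natrD natrM => h.
have k0 : k.+1%:R != 0 :> R by rewrite pnatr_eq0.
apply: (mulfI k0); rewrite [RHS]mulrC -[RHS]h; ring.
Qed.

Lemma sphere_coord_sum (m : 'rV[R]_n.+1) : sphere n.+1 m ->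
  \sum_(i < n.+1 | i != ord0) m ord0 i ^+ 2 = 1 - m ord0 ord0 ^+ 2.
Proof.
move=> /sphere_dotxx; rewrite /dot (bigD1 ord0)//= -expr2 => <-.
by rewrite [X in _ = X - _]addrC addrK; apply: eq_bigr => i _; rewrite expr2.
Qed.

Lemma bounded_latitude p : sphere_bounded (fun m : 'rV[R]_n.+1 => (m ord0 ord0 ^+ 2) ^+ p).
Proof. by apply: boundedX; apply: boundedX; exact: bounded_coord. Qed.

Lemma card_tangent : #|[pred i : 'I_n.+1 | i != ord0]| = n.
Proof.
have := cardC1 (ord0 : 'I_n.+1); rewrite card_ord/= => h; apply: (etrans _ h).
by apply: eq_card => i; rewrite !inE.
Qed.

Lemma Rintegral_bounded_sum (P : pred 'I_n.+1) (F : 'I_n.+1 -> 'rV[R]_n.+1 -> R) :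
  (forall i, sphere_bounded (F i)) ->
  \int[area]_m (\sum_(i < n.+1 | P i) F i m) = \sum_(i < n.+1 | P i) \int[area]_m F i m.
Proof.
move=> bF; under eq_Rintegral do rewrite big_mkcond/=.
rewrite Rintegral_sum//.
  rewrite [RHS]big_mkcond; apply: eq_bigr => i _; case: (P i) => //.
  by rewrite Rintegral_cst// mul0r.
move=> i; case: (P i); [exact: integrable_bounded|exact: integrable_cst].
Qed.

(** Sums moment_rotation over the n coordinates orthogonal to the first axis,
    whose squares add up to 1 - s. *)
Lemma sphere_moment_rec k :
  (2 * k%:R + 1) * \int[area]_m ((m ord0 ord0 ^+ 2) ^+ k) =
  (n.+1%:R + 2 * k%:R) * \int[area]_m ((m ord0 ord0 ^+ 2) ^+ k.+1).
Proof.
have E j : \int[area]_m ((m ord0 ord0 ^+ 2) ^+ j) = \int[area]_m (m ord0 ord0 ^+ (2 * j)).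
  by apply: eq_Rintegral => m _; rewrite exprM.
have bi (i : 'I_n.+1) : sphere_bounded (fun m : 'rV[R]_n.+1 => (m ord0 ord0 ^+ 2) ^+ k * m ord0 i ^+ 2).
  by apply: boundedM; [exact: bounded_latitude|apply: boundedX; exact: bounded_coord].
have h : \sum_(i < n.+1 | i != ord0) \int[area]_m ((m ord0 ord0 ^+ 2) ^+ k * m ord0 i ^+ 2) =
  \int[area]_m ((m ord0 ord0 ^+ 2) ^+ k) - \int[area]_m ((m ord0 ord0 ^+ 2) ^+ k.+1).
  rewrite -Rintegral_bounded_sum//.
  rewrite -RintegralB//; try exact: (integrable_bounded (bounded_latitude _)).
  apply: eq_sphere_Rintegral.
  - by have [] := bounded_sum (index_enum _) (fun i => i != ord0) bi.
  - by have [] := boundedB (bounded_latitude k) (bounded_latitude k.+1).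
  - move=> m Sm; rewrite -mulr_sumr sphere_coord_sum// [_ ^+ k.+1]exprS; ring.
have := h; rewrite (eq_bigr (fun=> \int[area]_m ((m ord0 ord0 ^+ 2) ^+ k.+1) / (2 * k%:R + 1))).
  rewrite sumr_const card_tangent -[_ *+ n]mulr_natr => {}h.
  have k0 : 2 * k%:R + 1 != 0 :> R by rewrite gt_eqF// addr_gt0// mulr_ge0.
  have -> : \int[area]_m ((m ord0 ord0 ^+ 2) ^+ k) =
    \int[area]_m ((m ord0 ord0 ^+ 2) ^+ k.+1) / (2 * k%:R + 1) * n%:R +
    \int[area]_m ((m ord0 ord0 ^+ 2) ^+ k.+1) by rewrite h subrK.
  by rewrite -natr1; field.
move=> i i0; have k0 : 2 * k%:R + 1 != 0 :> R by rewrite gt_eqF// ltr_wpDl// mulr_ge0.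
rewrite E -(moment_rotation k i0) mulrAC divff// mul1r.
by apply: eq_Rintegral => m _; rewrite exprM.
Qed.

(** On the sphere and on the meridian, the power moments of the squared latitude
    obey the same recursion, hence are proportional; the exponential series
    carries this over to the weight e^(eta s). *)
Lemma sphere_angular_moment p (eta : R) : (0 < n)%N ->
  \int[area]_m (expR (eta * m ord0 ord0 ^+ 2) * (m ord0 ord0 ^+ 2) ^+ p) =
  fine (area setT) / angular_moment n.+1 0 0 * angular_moment n.+1 p eta.
Proof.
move=> n0; set C := _ / _.
have mom k : \int[area]_m ((m ord0 ord0 ^+ 2) ^+ k) = C * angular_moment n.+1 k 0.
  elim: k => [|k ih].
    under eq_Rintegral do rewrite expr0.
    by rewrite Rintegral_cst// mul1r /C divfK// gt_eqF// mass_gt0.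
  have h1 := sphere_moment_rec k; have h2 := @angular_moment_rec R n.+1 k 0 n0.
  have c0 : n.+1%:R + 2 * k%:R != 0 :> R by rewrite gt_eqF// ltr_wpDr// mulr_ge0.
  apply: (mulfI c0); rewrite -h1 ih mulrCA [RHS]mulrCA; congr (_ * _).
  by move: h2; rewrite mulr0 mul0r addr0; lra.
have mS := @measurable_sphere R n.+1.
have bs q := @bounded_latitude q.
have bE q : sphere_bounded (fun m : 'rV[R]_n.+1 => expR (eta * m ord0 ord0 ^+ 2) * (m ord0 ord0 ^+ 2) ^+ q).
  apply: boundedM => //; apply: bounded_expR; apply: boundedM; first exact: bounded_cst.
  exact: (bs 1%N).
rewrite Rintegral_sphere; last exact: integrable_bounded.
have iS q : area.-integrable (sphere n.+1) (EFin \o (fun m : 'rV[R]_n.+1 => (m ord0 ord0 ^+ 2) ^+ q)).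
  by apply/sphere_integrableP; [case: (bs q)|exact: integrable_bounded].
have s01 (m : 'rV[R]_n.+1) : sphere n.+1 m -> 0 <= m ord0 ord0 ^+ 2 <= 1.
  move=> Sm; rewrite sqr_ge0 -real_normK ?num_real//=.
  by rewrite exprn_ile1// sphere_coord_le1.
have ms : measurable_fun (sphere n.+1) (fun m : 'rV[R]_n.+1 => m ord0 ord0 ^+ 2).
  by apply: measurable_funTS; case: (bs 1%N).
have lim1 := cvg_exp_moments mS s01 ms (iS p) (eta := eta).
pose q0 := `[0, pi / 2 : R]%classic.
have mQ : measurable (q0 : set (measurableTypeR R)) by exact: measurable_itv.
have iQ : (@lebesgue_measure R).-integrable q0
    (EFin \o (fun t => (sin t ^+ 2) ^+ p * cos t ^+ (n.+1 - 2))).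
  have := angular_moment_integrable n.+1 p (0 : R); apply: eq_integrable => // t _ /=.
  by rewrite mul0r expR0 mul1r.
have t01 (t : R) : q0 t -> 0 <= sin t ^+ 2 <= 1.
  by move=> _; exact: sin2_itv01.
have mt : measurable_fun (q0 : set (measurableTypeR R)) (fun t : R => sin t ^+ 2).
  apply: measurable_funTS; apply: continuous_measurable_fun => t.
  apply: (@continuous_comp _ _ _ sin (fun x : R => x ^+ 2)).
    exact: continuous_sin.
  exact: exprn_continuous.
have lim2 := cvg_exp_moments mQ t01 mt iQ (eta := eta).
have E2 : \int[lebesgue_measure]_(t in q0) (expR (eta * sin t ^+ 2) *
    ((sin t ^+ 2) ^+ p * cos t ^+ (n.+1 - 2))) = angular_moment n.+1 p eta.
  by apply: eq_Rintegral => t _; rewrite mulrA.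
rewrite E2 in lim2.
set u := (fun N => _) in lim1; set v := (fun N => _) in lim2.
have uE : u = (fun N => C * v N).
  apply/funext => N; rewrite /u /v /= mulr_sumr; apply: eq_bigr => k _.
  rewrite mulrCA; congr (_ * _).
  transitivity (C * angular_moment n.+1 (k + p) 0).
    transitivity (\int[area]_m ((m ord0 ord0 ^+ 2) ^+ (k + p))); last exact: mom.
    rewrite Rintegral_sphere; last exact: integrable_bounded.
    by apply: eq_Rintegral => m _; rewrite exprD.
  congr (_ * _); apply: eq_Rintegral => t _.
  by rewrite mul0r expR0 mul1r exprD mulrA.
transitivity (lim (u @ \oo)); first by apply/esym/cvg_lim => //; exact: lim1.
apply: cvg_lim => //; rewrite uE; apply: cvgM; [exact: cvg_cst|exact: lim2].
Qed.
End sphere_moments.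

(** * Fourth moments for an axisymmetric weight *)

Section sphere_area.
Context {R : realType}.

Definition box n (c : R) : set 'rV[R]_n := [set x | forall i, 0 < x ord0 i <= c].

Lemma boxS n c : @box n.+1 c = @rV_uncons R n @^-1` (`]0, c]%classic `*` @box n c).
Proof.
apply/seteqP; split => x /=.
  move=> cx; split; first by rewrite /= in_itv/=; exact: cx.
  by move=> i; rewrite mxE; exact: cx.
move=> [] /=; rewrite in_itv/= => x0 xS i.
case: (unliftP ord0 i) => [j|] -> //.
by have := xS j; rewrite mxE.
Qed.

Lemma measurable_box n c : measurable (@box n c).
Proof.
elim: n => [|n ih].
  have -> : @box 0 c = setT by apply/seteqP; split => x //= _ [].
  exact: measurableT.
rewrite boxS -[X in measurable X]setTI; apply: measurable_rV_uncons => //.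
exact: measurableX.
Qed.

Lemma lebesgue_box_gt0 n c : 0 < c -> (0 < lebesgue_rV R n (@box n c))%E.
Proof.
move=> c0; elim: n => [|n ih].
  have -> : @box 0 c = setT by apply/seteqP; split => x //= _ [].
  by rewrite /= diracT lte01.
rewrite /= /lebesgue_rV_succ /pushforward boxS.
rewrite -comp_preimage (_ : _ \o _ = id) ?preimage_id; last first.
  by apply/funext => p /=; rewrite rV_consK.
rewrite product_measure1E//; last exact: measurable_box.
have I0 : (0 < lebesgue_measure (`]0%R, c]%classic : set R))%E.
  by rewrite lebesgue_measure_itv/= lte_fin c0 -EFinD subr0 lte_fin.
exact: mule_gt0.
Qed.

(** The punctured ball contains a box. *)
Lemma sphere_area_gt0 n : 0 < fine (@sphere_measure R n.+1 setT).
Proof.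
rewrite fine_gt0//; apply/andP; split; last first.
  by rewrite -ge0_fin_numE// fin_num_measure.
rewrite /sphere_measure preimage_setT setTI.
apply: mule_gt0; first by rewrite lte_fin ltr0n.
apply: (lt_le_trans (@lebesgue_box_gt0 n.+1 n.+1%:R^-1 _)).
  by rewrite invr_gt0 ltr0n.
apply: le_measure.
- by rewrite inE; exact: measurable_box.
- by rewrite inE; exact: measurable_punctured_ball.
move=> x bx; rewrite /punctured_ball/=.
have x0 : 0 < dot x x.
  rewrite lt_neqAle dotxx_ge0 eq_sym dotxx_eq0 andbT; apply/eqP => x0.
  by have := bx ord0; rewrite x0 mxE ltxx.
rewrite /enorm sqrtr_gt0 x0/= -sqrtr1 ler_sqrt//.
apply: (@le_trans _ _ (\sum_(i < n.+1) n.+1%:R^-1)).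
  apply: ler_sum => i _; have /andP[a b] := bx i.
  have c1 : n.+1%:R^-1 <= 1 :> R by rewrite invf_le1 ?ler1n ?ltr0n.
  by rewrite -[leRHS]mul1r; apply: ler_pM => //; [exact: ltW|exact: ltW|exact: le_trans b c1].
by rewrite sumr_const card_ord -[_ *+ n.+1]mulr_natr mulVf// pnatr_eq0.
Qed.
End sphere_area.

Section fourth_moments.
Context {R : realType}.
Variables (n : nat) (eta : R).
Hypothesis n2 : (2 <= n)%N.
Local Notation area := (@sphere_measure R n.+1).
Local Notation e i := (delta_mx ord0 i : 'rV[R]_n.+1).
Local Notation J p := (angular_moment n.+1 p eta).

Definition latitude_weight (m : 'rV[R]_n.+1) : R := expR (eta * m ord0 ord0 ^+ 2).
Local Notation w := latitude_weight.

(** The factor of proportionality between integrals over the sphere and over the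
    meridian. *)
Definition sphere_scale : R := fine (area setT) / angular_moment n.+1 0 0.

Lemma sphere_scale_gt0 : 0 < sphere_scale.
Proof. by rewrite divr_gt0 ?sphere_area_gt0 ?mass_gt0. Qed.

Lemma bounded_weight : sphere_bounded w.
Proof.
apply: (@bounded_expR _ _ (fun m => eta * m ord0 ord0 ^+ 2)).
apply: boundedM; first exact: bounded_cst.
by apply: boundedX; exact: bounded_coord.
Qed.

Lemma latitude_moment p :
  \int[area]_m (w m * (m ord0 ord0 ^+ 2) ^+ p) = sphere_scale * J p.
Proof. by apply: sphere_angular_moment; exact: ltnW. Qed.

Lemma reflection_delta (t a : 'I_n.+1) (m : 'rV[R]_n.+1) :
  reflection (e t) m ord0 a = (-1) ^+ (a == t) * m ord0 a.
Proof.
rewrite /reflection !mxE eqxx !dot_delta mxE !eqxx/= divr1.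
by case: eqP => [->|_]/=; rewrite ?mulr1 ?mulr0 ?expr0 ?expr1; ring.
Qed.

Lemma bounded_quartic a b c d :
  sphere_bounded (fun m : 'rV[R]_n.+1 => w m * (m ord0 a * m ord0 b * (m ord0 c * m ord0 d))).
Proof.
apply: boundedM; first exact: bounded_weight.
by apply: boundedM; apply: boundedM; exact: bounded_coord.
Qed.

(** Reflecting the coordinate t changes the sign of the integrand. *)
Lemma odd_moment (t a b c d : 'I_n.+1) :
  odd ((a == t) + (b == t) + ((c == t) + (d == t))) ->
  \int[area]_m (w m * (m ord0 a * m ord0 b * (m ord0 c * m ord0 d))) = 0.
Proof.
move=> od; set I := LHS.
suff : I = - I by move=> h; lra.
rewrite {1}/I -(Rintegral_reflection (e t) (bounded_quartic a b c d)) -mulN1r -RintegralZl//; last first.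
  exact: integrable_bounded (bounded_quartic _ _ _ _).
apply: eq_Rintegral => m _; rewrite /w !reflection_delta.
rewrite exprMn -exprM mulnC exprM sqrrN expr1n expr1n mul1r -/(w m).
transitivity (((-1) ^+ (a == t) * (-1) ^+ (b == t) * ((-1) ^+ (c == t) * (-1) ^+ (d == t))) *
  (w m * (m ord0 a * m ord0 b * (m ord0 c * m ord0 d)))); first by ring.
by rewrite -!exprD -signr_odd od expr1.
Qed.

Definition pair_moment (i j : 'I_n.+1) : R :=
  \int[area]_m (w m * (m ord0 i ^+ 2 * m ord0 j ^+ 2)).

Lemma quartic_offdiag k l i j : k != l ->
  \int[area]_m (w m * (m ord0 k * m ord0 l * (m ord0 i * m ord0 j))) =
  ((i == k) && (j == l) || (i == l) && (j == k))%:R * pair_moment k l.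
Proof.
move=> kl; have [|] := boolP ((i == k) && (j == l) || (i == l) && (j == k)); last first.
  (* Otherwise some index occurs an odd number of times: k when i = j or when k
     differs from both i and j, and l in the remaining cases. *)
  rewrite negb_or mul0r => /andP[h1 h2].
  have [ij|ij] := eqVneq i j.
    rewrite ij in h1 h2 *; apply: (odd_moment (t := k)).
    by rewrite eqxx eq_sym (negbTE kl); case: (j == k).
  have [ik|ik] := eqVneq i k.
    apply: (odd_moment (t := l)); rewrite eqxx (negbTE kl).
    move: h1 h2; rewrite ik eqxx/= (negbTE kl)/= => /negbTE -> _.
    by [].
  have [jk|jk] := eqVneq j k.
    apply: (odd_moment (t := l)); rewrite eqxx (negbTE kl).
    move: h1 h2; rewrite jk eqxx/= andbT (negbTE kl)/= => _ /negbTE ->.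
    by [].
  apply: (odd_moment (t := k)).
  by rewrite eqxx (negbTE ik) (negbTE jk) eq_sym (negbTE kl).
rewrite mul1r /pair_moment => /orP[] /andP[/eqP -> /eqP ->];
  by apply: eq_Rintegral => m _; ring.
Qed.

Lemma quartic_diag k i j :
  \int[area]_m (w m * (m ord0 k * m ord0 k * (m ord0 i * m ord0 j))) =
  (i == j)%:R * pair_moment k i.
Proof.
have [<-|ij] := eqVneq i j.
  by rewrite mul1r /pair_moment; apply: eq_Rintegral => m _; ring.
rewrite mul0r; have [ik|ik] := eqVneq i k.
  apply: (odd_moment (t := j)); rewrite -ik (negbTE ij) eqxx.
  by [].
apply: (odd_moment (t := i)); rewrite eqxx eq_sym (negbTE ik) (eq_sym j) (negbTE ij).
by [].
Qed.

Lemma pair_momentC i j : pair_moment i j = pair_moment j i.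
Proof. by apply: eq_Rintegral => m _; rewrite (mulrC (_ ^+ 2)). Qed.

Lemma pair_moment00 : pair_moment ord0 ord0 = sphere_scale * J 2.
Proof. by rewrite -latitude_moment; apply: eq_Rintegral => m _; rewrite -expr2. Qed.

Lemma pair_moment0 i : i != ord0 ->
  pair_moment ord0 i = sphere_scale * (J 1 - J 2) / n%:R.
Proof.
move=> i0.
have n0 : n%:R != 0 :> R by rewrite pnatr_eq0 -lt0n ltnW.
have bi j : sphere_bounded (fun m : 'rV[R]_n.+1 => w m * (m ord0 ord0 ^+ 2 * m ord0 j ^+ 2)).
  apply: boundedM; first exact: bounded_weight.
  by apply: boundedM; apply: boundedX; exact: bounded_coord.
have b1 p : sphere_bounded (fun m : 'rV[R]_n.+1 => w m * (m ord0 ord0 ^+ 2) ^+ p).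
  by apply: boundedM; [exact: bounded_weight|exact: bounded_latitude].
have eqij j : j != ord0 -> pair_moment ord0 j = pair_moment ord0 i.
  move=> j0; rewrite /pair_moment.
  have h := @Rintegral_cap R n (fun t => expR (eta * t ^+ 2) * t ^+ 2) (fun t => t ^+ 2) (e j) (e i).
  under eq_Rintegral do rewrite mulrA -(dot_delta _ j).
  under [RHS]eq_Rintegral do rewrite mulrA -(dot_delta _ i).
  apply: h.
  - by rewrite !dot_delta2 !eqxx.
  - by rewrite !dot_delta2 (negbTE i0) (negbTE j0).
  - apply: boundedM; first exact: bounded_weight.
    by apply: boundedX; exact: bounded_coord.
  - by apply: boundedX; exact: bounded_dot.
have h : \sum_(j < n.+1 | j != ord0) pair_moment ord0 j = sphere_scale * (J 1 - J 2).
  rewrite mulrBr -!latitude_moment -RintegralB//; try exact: (integrable_bounded (b1 _)).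
  rewrite -Rintegral_bounded_sum//; apply: eq_sphere_Rintegral.
  - by have [] := bounded_sum (index_enum _) (fun i => i != ord0) bi.
  - by have [] := boundedB (b1 1%N) (b1 2%N).
  - move=> m Sm; rewrite -mulr_sumr -mulr_sumr sphere_coord_sum//.
    by rewrite !expr2 expr1; ring.
apply: (mulIf n0); rewrite divfK// -h (eq_bigr (fun=> pair_moment ord0 i))//.
by rewrite sumr_const card_tangent mulr_natr.
Qed.

Definition tangent_moment : R :=
  sphere_scale * (J 0 - 2 * J 1 + J 2) / (n%:R * (n%:R + 2)).

(** Directions orthogonal to the axis are equivalent. Turning by 45 degrees in
    the plane of two of them gives
    \int w (x_k + x_l)^4 = 4 \int w x_k^4, so the moment of x_k^2 x_l^2 is a
    third of that of x_k^4. All these moments add up to that of (1 - s)^2. *)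
Lemma pair_moment_tangent i j : i != ord0 -> j != ord0 ->
  pair_moment i j = (if i == j then 3 else 1) * tangent_moment.
Proof.
move=> i0 j0; have n0 : n%:R != 0 :> R by rewrite pnatr_eq0 -lt0n ltnW.
have n20 : n%:R + 2 != 0 :> R by rewrite -natrD pnatr_eq0 addn2.
have bi k l : sphere_bounded (fun m : 'rV[R]_n.+1 => w m * (m ord0 k ^+ 2 * m ord0 l ^+ 2)).
  apply: boundedM; first exact: bounded_weight.
  by apply: boundedM; apply: boundedX; exact: bounded_coord.
have b1 p : sphere_bounded (fun m : 'rV[R]_n.+1 => w m * (m ord0 ord0 ^+ 2) ^+ p).
  by apply: boundedM; [exact: bounded_weight|exact: bounded_latitude].
pose q k := \int[area]_m (w m * m ord0 k ^+ 4).
have qE k : pair_moment k k = q k.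
  by apply: eq_Rintegral => m _; rewrite -exprD.
have eq_q k l : k != ord0 -> l != ord0 -> q k = q l.
  move=> k0 l0; rewrite /q.
  have h := @Rintegral_cap R n (fun t => expR (eta * t ^+ 2)) (fun t => t ^+ 4) (e k) (e l).
  under eq_Rintegral do rewrite -(dot_delta _ k).
  under [RHS]eq_Rintegral do rewrite -(dot_delta _ l).
  apply: h.
  - by rewrite !dot_delta2 !eqxx.
  - by rewrite !dot_delta2 (negbTE k0) (negbTE l0).
  - exact: bounded_weight.
  - by apply: boundedX; exact: bounded_dot.
have off k l : k != ord0 -> l != ord0 -> k != l -> 3 * pair_moment k l = q k.
  move=> k0 l0 kl.
  (* Both vectors have squared length 2. *)
  pose a := e k + e l; pose b := Num.sqrt 2 *: e k.
  have ab : dot a a = dot b b.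
    rewrite /a /b !(dotDl, dotDr, dotZl, dotZr) !dot_delta2 !eqxx (negbTE kl) eq_sym (negbTE kl).
    by rewrite mulr1 -expr2 sqr_sqrtr// addr0 add0r.
  have a0 : dot a (e ord0) = dot b (e ord0).
    by rewrite /a /b !(dotDl, dotZl) !dot_delta2 (negbTE k0) (negbTE l0) mulr0 addr0.
  have := @Rintegral_cap R n (fun t => expR (eta * t ^+ 2)) (fun t => t ^+ 4) a b ab a0
    bounded_weight (boundedX _ (bounded_dot _)).
  have -> : \int[area]_m (w m * dot m b ^+ 4) = 4 * q k.
    rewrite /q -RintegralZl//; last first.
      apply: integrable_bounded; apply: boundedM; first exact: bounded_weight.
      by apply: boundedX; exact: bounded_coord.
    apply: eq_Rintegral => m _; rewrite /b dotZr dot_delta exprMn (exprM (Num.sqrt 2) 2 2) sqr_sqrtr//.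
    by ring.
  pose Q (c1 c2 c3 c4 : 'I_n.+1) (m : 'rV[R]_n.+1) :=
    w m * (m ord0 c1 * m ord0 c2 * (m ord0 c3 * m ord0 c4)).
  have iQ c c1 c2 c3 c4 : sphere_integrable (fun m => c * Q c1 c2 c3 c4 m).
    apply: integrable_bounded; apply: boundedM; [exact: bounded_cst|exact: bounded_quartic].
  have iQ1 c1 c2 c3 c4 : sphere_integrable (Q c1 c2 c3 c4).
    exact: integrable_bounded (bounded_quartic _ _ _ _).
  have -> : \int[area]_m (w m * dot m a ^+ 4) = \int[area]_m (1 * Q k k k k m +
    (4 * Q k l k k m + (6 * Q k k l l m + (4 * Q k l l l m + 1 * Q l l l l m)))).
    apply: eq_Rintegral => m _; rewrite /a dotDr !dot_delta /Q; ring.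
  have i1 := integrable_add (iQ 4 k l l l) (iQ 1 l l l l).
  have i2 := integrable_add (iQ 6 k k l l) i1.
  have i3 := integrable_add (iQ 4 k l k k) i2.
  rewrite (RintegralD measurableT (iQ 1 k k k k) i3) (RintegralD measurableT (iQ 4 k l k k) i2).
  rewrite (RintegralD measurableT (iQ 6 k k l l) i1).
  rewrite (RintegralD measurableT (iQ 4 k l l l) (iQ 1 l l l l)).
  do 5 ! (rewrite RintegralZl//; last exact: iQ1).
  rewrite /Q !quartic_diag (quartic_offdiag _ _ kl) (quartic_offdiag _ _ kl).
  rewrite !eqxx (negbTE kl) (eq_sym l k) (negbTE kl) /= !qE (eq_q l k)//; lra.
have pE k l : k != ord0 -> l != ord0 ->
    pair_moment k l = (if k == l then 3 else 1) * (q i / 3).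
  move=> k0 l0; have [<-|kl] := eqVneq k l; first by rewrite qE (eq_q k i)//; field.
  by have := off k l k0 l0 kl; rewrite (eq_q k i)//; lra.
suff -> : tangent_moment = q i / 3 by exact: pE.
have h : \sum_(k < n.+1 | k != ord0) \sum_(l < n.+1 | l != ord0) pair_moment k l =
    sphere_scale * (J 0 - 2 * J 1 + J 2).
  transitivity (\int[area]_m (w m * (m ord0 ord0 ^+ 2) ^+ 0 - 2 * (w m * (m ord0 ord0 ^+ 2) ^+ 1) +
    w m * (m ord0 ord0 ^+ 2) ^+ 2)).
    transitivity (\sum_(k < n.+1 | k != ord0) \int[area]_m \sum_(l < n.+1 | l != ord0)
       (w m * (m ord0 k ^+ 2 * m ord0 l ^+ 2))).
      by apply: eq_bigr => k _; rewrite -Rintegral_bounded_sum.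
    have bk k := bounded_sum (index_enum _) (fun i => i != ord0) (bi k).
    rewrite -Rintegral_bounded_sum//.
    apply: eq_sphere_Rintegral.
    - by have [] := bounded_sum (index_enum _) (fun i => i != ord0) bk.
    - by have [] := boundedD (boundedB (b1 0) (boundedM (bounded_cst 2) (b1 1))) (b1 2).
    - move=> m Sm.
      under eq_bigr => k _ do rewrite -mulr_sumr -mulr_sumr sphere_coord_sum// mulrCA.
      rewrite -mulr_suml sphere_coord_sum// !expr1 expr0; ring.
  rewrite RintegralD//; last 2 first.
  - apply: integrable_sub; apply: integrable_bounded => //.
    by apply: boundedM => //; exact: bounded_cst.
  - exact: integrable_bounded.
  rewrite RintegralB//; last 2 first.
  - exact: integrable_bounded.
  - by apply: integrable_bounded; apply: boundedM => //; exact: bounded_cst.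
  rewrite RintegralZl//; last exact: integrable_bounded.
  by rewrite !latitude_moment; ring.
rewrite /tangent_moment -h.
have hk k : k != ord0 -> \sum_(l < n.+1 | l != ord0) pair_moment k l = (n%:R + 2) * (q i / 3).
  move=> k0; rewrite (bigD1 k)//= pE// eqxx (eq_bigr (fun=> q i / 3)); last first.
    by move=> l /andP[l0 lk]; rewrite pE// eq_sym (negbTE lk) mul1r.
  have := card_tangent n; rewrite (cardD1 k) inE k0 add1n => cE.
  rewrite sumr_const.
  have -> : #|[pred l : 'I_n.+1 | (l != ord0) && (l != k)]| = n.-1.
    by rewrite -[in RHS]cE /=; apply: eq_card => l; rewrite !inE andbC.
  rewrite -[_ *+ n.-1]mulr_natr -subn1 natrB ?(ltnW n2)//; ring.
rewrite (eq_bigr (fun=> (n%:R + 2) * (q i / 3)))//.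
rewrite sumr_const card_tangent -[_ *+ n]mulr_natr.
by field; rewrite n0 n20.
Qed.
End fourth_moments.

(** * Square-integrable functions on the sphere *)

Section square_integrable.
Context {R : realType} {n : nat}.
Local Notation area := (@sphere_measure R n).
Implicit Types f g : 'rV[R]_n -> R.

Lemma Lnorm2E f : ('N[area]_2%:E[EFin \o f] =
  (\int[area]_m (f m ^+ 2)%:E) `^ 2^-1)%E.
Proof.
rewrite unlock; congr (_ `^ _)%E; apply: eq_integral => m _ /=.
by rewrite powR_mulrn// -normrX ger0_norm// sqr_ge0.
Qed.

Lemma Lfun2P f : f \in Lfun area 2%:E <->
  measurable_fun setT f /\ sphere_integrable (fun m => f m ^+ 2).
Proof.
split=> [fL|[mf f2]].
  split; last exact: Lfun2_integrable_sqr fL.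
  by move: fL; rewrite inE => /andP[]; rewrite inE.
rewrite inE; apply/andP; split; rewrite inE//= /finite_norm Lnorm2E.
rewrite poweR_lty//; apply: (integrable_lty measurableT f2).
Qed.

Lemma norm_L2_sqr f : sphere_integrable (fun m => f m ^+ 2) ->
  norm_L2 f ^+ 2 = \int[area]_m (f m ^+ 2).
Proof.
move=> f2; rewrite /norm_L2 Lnorm2E -[in LHS](fineK (integrable_fin_num measurableT f2)).
rewrite /= powR12_sqrt ?sqr_sqrtr//; apply: Rintegral_ge0 => m _; exact: sqr_ge0.
Qed.

Lemma square_integrable f : measurable_fun setT f ->
  sphere_integrable (fun m => f m ^+ 2) -> sphere_integrable f.
Proof.
move=> mf f2.
have h : sphere_integrable (fun m => 1 + f m ^+ 2) := integrable_add (integrable_cst 1) f2.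
apply: (le_integrable measurableT _ _ h); first exact/measurable_EFinP.
move=> m _ /=; rewrite lee_fin [leRHS]ger0_norm ?addr_ge0 ?sqr_ge0//.
have := sqr_ge0 (`|f m| - 1); rewrite -(real_normK (num_real (f m))).
have := normr_ge0 (f m); nra.
Qed.

Lemma integrable_scale c f : sphere_integrable f -> sphere_integrable (fun m => c * f m).
Proof. by apply: integrable_bounded_mul; exact: bounded_cst. Qed.

Lemma ae_eq_sphere f g : (forall m, sphere n m -> f m = g m) -> f = g %[ae area].
Proof.
move=> fg; exists (~` @sphere R n); split.
- exact: measurableC measurable_sphere.
- exact: sphere_measureC.
- by move=> m /= h Sm; apply: h => _; rewrite fg.
Qed.

Lemma eq_ae_Rintegral f g : measurable_fun setT f -> measurable_fun setT g ->
  f = g %[ae area] -> \int[area]_m f m = \int[area]_m g m.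
Proof.
move=> mf mg fg; congr fine; apply: ae_eq_integral => //; try exact/measurable_EFinP.
by apply: filterS fg => m h /h /= ->.
Qed.

Lemma Rintegral_sqr_eq0 f : sphere_integrable (fun m => f m ^+ 2) ->
  measurable_fun setT f -> \int[area]_m (f m ^+ 2) <= 0 -> f = cst 0 %[ae area].
Proof.
move=> f2 mf f0.
have i0 : (\int[area]_m `|(f m ^+ 2)%:E| = 0)%E.
  have -> : (\int[area]_m `|(f m ^+ 2)%:E| = \int[area]_m (f m ^+ 2)%:E)%E.
    by apply: eq_integral => m _; rewrite gee0_abs// lee_fin sqr_ge0.
  rewrite -(fineK (integrable_fin_num measurableT f2)); congr (_%:E).
  apply/eqP; rewrite eq_le; apply/andP; split; first exact: f0.
  by apply: Rintegral_ge0 => m _; exact: sqr_ge0.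
have mf2 : measurable_fun setT (fun m => (f m ^+ 2)%:E).
  by apply/measurable_EFinP; exact: measurable_funX.
have [h _] := ae_eq_integral_abs area measurableT mf2.
apply: filterS (h i0) => m h' /h' [] /eqP.
by rewrite sqrf_eq0 => /eqP.
Qed.
End square_integrable.

(** * Matrices split along the director *)

Section frobenius.
Context {R : realType}.
Variable n : nat.
Implicit Types S T : 'M[R]_n.+1.

Definition frobenius S T : R := \sum_k \sum_l S k l * T k l.

Lemma frobeniusC S T : frobenius S T = frobenius T S.
Proof. by apply: eq_bigr => k _; apply: eq_bigr => l _; rewrite mulrC. Qed.

Lemma frobeniusDr S T U : frobenius S (T + U) = frobenius S T + frobenius S U.
Proof.
rewrite /frobenius -big_split/=; apply: eq_bigr => k _.
by rewrite -big_split/=; apply: eq_bigr => l _; rewrite mxE mulrDr.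
Qed.

Lemma frobeniusZr S T c : frobenius S (c *: T) = c * frobenius S T.
Proof.
rewrite /frobenius mulr_sumr; apply: eq_bigr => k _.
by rewrite mulr_sumr; apply: eq_bigr => l _; rewrite mxE mulrCA.
Qed.

Lemma frobeniusDl S T U : frobenius (T + U) S = frobenius T S + frobenius U S.
Proof. by rewrite frobeniusC frobeniusDr !(frobeniusC S). Qed.

Lemma frobeniusZl S T c : frobenius (c *: T) S = c * frobenius T S.
Proof. by rewrite frobeniusC frobeniusZr (frobeniusC S). Qed.

Lemma frobenius_ge0 S : 0 <= frobenius S S.
Proof. by apply: sumr_ge0 => k _; apply: sumr_ge0 => l _; rewrite -expr2 sqr_ge0. Qed.

(** The index ord0 stands for the director. Under the rotations that fix the
    director, traceless symmetric matrices split into the multiples of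
    axial_mx 1 (- n^-1), the mixed matrices and the transverse ones. *)
Definition axial_mx (a b : R) : 'M[R]_n.+1 :=
  \matrix_(k, l) ((k == l)%:R * (if k == ord0 then a else b)).

Lemma frobenius_axial a b S :
  frobenius (axial_mx a b) S = a * S ord0 ord0 + b * \sum_(k | k != ord0) S k k.
Proof.
have E k : \sum_l axial_mx a b k l * S k l = (if k == ord0 then a else b) * S k k.
  rewrite (bigD1 k)//= big1 ?addr0; first by rewrite mxE eqxx mul1r.
  by move=> l lk; rewrite mxE eq_sym (negbTE lk) !mul0r.
rewrite /frobenius (bigD1 ord0)//= E eqxx mulr_sumr; congr (_ + _).
by apply: eq_bigr => k k0; rewrite E (negbTE k0).
Qed.

Definition is_mixed T := forall k l, (k == ord0) = (l == ord0) -> T k l = 0.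

Definition is_transverse T :=
  (forall k l, (k == ord0) || (l == ord0) -> T k l = 0) /\ \sum_(k | k != ord0) T k k = 0.

Lemma frobenius_axial_mixed a b T : is_mixed T -> frobenius (axial_mx a b) T = 0.
Proof.
move=> hT; rewrite frobenius_axial hT// mulr0 add0r.
by rewrite big1 ?mulr0// => k _; rewrite hT.
Qed.

Lemma frobenius_axial_transverse a b T : is_transverse T -> frobenius (axial_mx a b) T = 0.
Proof. by move=> [h1 h2]; rewrite frobenius_axial h1 ?eqxx// h2 !mulr0 addr0. Qed.

Lemma frobenius_mixed_transverse S T : is_mixed S -> is_transverse T -> frobenius S T = 0.
Proof.
move=> hS [hT _]; apply: big1 => k _; apply: big1 => l _.
have [kl|kl] := eqVneq (k == ord0) (l == ord0); first by rewrite hS// mul0r.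
rewrite hT ?mulr0//; move: kl; by case: (k == _); case: (l == _).
Qed.

Definition mixed_part S : 'M[R]_n.+1 :=
  \matrix_(k, l) (if (k == ord0) == (l == ord0) then 0 else S k l).

Definition transverse_part S : 'M[R]_n.+1 :=
  \matrix_(k, l) (if (k == ord0) || (l == ord0) then 0
                  else S k l + (k == l)%:R * (S ord0 ord0 / n%:R)).

Lemma mixed_part_mixed S : is_mixed (mixed_part S).
Proof. by move=> k l kl; rewrite mxE kl eqxx. Qed.

Lemma transverse_part_transverse S : (0 < n)%N -> \tr S = 0 ->
  is_transverse (transverse_part S).
Proof.
move=> n0 trS; split=> [k l kl|]; first by rewrite mxE kl.
transitivity (\sum_(k < n.+1 | k != ord0) (S k k + S ord0 ord0 / n%:R)).
  by apply: eq_bigr => k k0; rewrite mxE (negbTE k0) eqxx mul1r.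
rewrite big_split/= sumr_const card_tangent -[_ *+ n]mulr_natr divfK ?pnatr_eq0 -?lt0n//.
by move: trS; rewrite /mxtrace (bigD1 ord0)//= addrC.
Qed.

Lemma axial_decomposition S :
  S = S ord0 ord0 *: axial_mx 1 (- n%:R^-1) + mixed_part S + transverse_part S.
Proof.
apply/matrixP => k l; rewrite !mxE.
have [->|k0] := eqVneq k ord0.
  have [->|l0] := eqVneq l ord0; first by rewrite !eqxx/= !mul1r mulr1 !addr0.
  by rewrite /= !mul0r mulr0 add0r addr0.
have [->|l0] /= := eqVneq l ord0; first by rewrite ?(negbTE k0)/= mul0r mulr0 add0r addr0.
by case: (k == l); rewrite /= ?mul1r ?mul0r ?mulr0 ?addr0 ?add0r//; ring.
Qed.

Lemma frobenius_decomposition a b c d (S T U V : 'M[R]_n.+1) :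
  is_mixed T -> is_mixed S -> is_transverse U -> is_transverse V ->
  frobenius (axial_mx a b + S + U) (axial_mx c d + T + V) =
  (a * c + n%:R * (b * d)) + frobenius S T + frobenius U V.
Proof.
move=> hT hS hU hV; rewrite !(frobeniusDl, frobeniusDr).
rewrite (frobeniusC S (axial_mx _ _)) (frobeniusC U (axial_mx _ _)).
rewrite !(frobenius_axial_mixed _ _ hT, frobenius_axial_mixed _ _ hS).
rewrite !(frobenius_axial_transverse _ _ hU, frobenius_axial_transverse _ _ hV).
rewrite (frobeniusC U T) (frobenius_mixed_transverse hT hU) (frobenius_mixed_transverse hS hV).
rewrite frobenius_axial mxE eqxx mul1r (eq_bigr (fun=> d)); last first.
  by move=> k k0; rewrite mxE eqxx (negbTE k0) mul1r.
rewrite sumr_const card_tangent -[_ *+ n]mulr_natr; ring.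
Qed.

Lemma axialZ a b c : c *: axial_mx a b = axial_mx (c * a) (c * b).
Proof. by apply/matrixP => k l; rewrite !mxE mulrCA; case: ifP. Qed.

Lemma mixedZ c T : is_mixed T -> is_mixed (c *: T).
Proof. by move=> hT k l kl; rewrite mxE hT// mulr0. Qed.

Lemma transverseZ c T : is_transverse T -> is_transverse (c *: T).
Proof.
move=> [h1 h2]; split=> [k l kl|]; first by rewrite mxE h1// mulr0.
transitivity (\sum_(k < n.+1 | k != ord0) c * T k k); first by apply: eq_bigr => k _; rewrite mxE.
by rewrite -mulr_sumr h2 mulr0.
Qed.
End frobenius.

(** * Second moments under the equilibrium density *)

Section second_moments.
Context {R : realType}.
Variables (n : nat) (eta : R) (nu : 'rV[R]_n.+1).
Hypothesis n2 : (2 <= n)%N.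
Hypothesis nu1 : sphere n.+1 nu.
Local Notation area := (@sphere_measure R n.+1).
Local Notation e0 := (delta_mx ord0 ord0 : 'rV[R]_n.+1).
Local Notation J p := (angular_moment n.+1 p eta).
Local Notation h := (equilibrium eta nu).

(** The reflection exchanging nu and the first basis vector provides coordinates
    in an orthonormal frame whose first vector is nu. *)
Definition frame (i : 'I_n.+1) (m : 'rV[R]_n.+1) : R := reflection (nu - e0) m ord0 i.

Lemma frame_norm : dot nu nu = dot e0 e0.
Proof. by rewrite sphere_dotxx// dot_delta2. Qed.

Lemma frame0 m : frame ord0 m = dot m nu.
Proof. by rewrite /frame -dot_delta reflection_sym reflection_swapC // frame_norm. Qed.

Lemma frame_dot m m' : dot m m' = \sum_i frame i m * frame i m'.
Proof. by rewrite -(reflection_isometry (nu - e0)). Qed.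

Lemma frame_sphere m : sphere n.+1 m -> \sum_i frame i m ^+ 2 = 1.
Proof. by move=> Sm; rewrite -(sphere_dotxx Sm) frame_dot; apply: eq_bigr => i _; rewrite expr2. Qed.

Lemma bounded_frame i : sphere_bounded (frame i).
Proof. exact: (bounded_reflection (nu - e0) (bounded_coord i)). Qed.

(** The normalization of the equilibrium, in a form that shows it does not depend
    on nu. *)
Definition partition_function : R := sphere_scale n * J 0.

Lemma partition_function_gt0 : 0 < partition_function.
Proof. by rewrite mulr_gt0 ?sphere_scale_gt0 ?mass_gt0. Qed.

Lemma equilibriumE m :
  h m = latitude_weight eta (reflection (nu - e0) m) / partition_function.
Proof.
rewrite /equilibrium -frame0; congr (_ / _).
rewrite /partition_function -latitude_moment//.
transitivity (\int[area]_m (latitude_weight eta (reflection (nu - e0) m))).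
  by apply: eq_Rintegral => m' _; rewrite -frame0.
rewrite (Rintegral_reflection _ (bounded_weight n eta)).
by apply: eq_Rintegral => m' _; rewrite expr0 mulr1.
Qed.

Lemma equilibrium_gt0 m : 0 < h m.
Proof. by rewrite equilibriumE divr_gt0 ?expR_gt0 ?partition_function_gt0. Qed.

Lemma equilibrium_bounded : sphere_bounded h.
Proof.
have := boundedM (bounded_reflection (nu - e0) (bounded_weight n eta))
  (bounded_cst partition_function^-1).
by congr sphere_bounded; apply/funext => m; rewrite equilibriumE.
Qed.

Lemma equilibriumV_bounded : sphere_bounded (fun m => (h m)^-1).
Proof.
have b : sphere_bounded (fun m => expR (- (eta * frame ord0 m ^+ 2))).
  apply: bounded_expR; apply: boundedN; apply: boundedM; first exact: bounded_cst.
  by apply: boundedX; exact: bounded_frame.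
have := boundedM (bounded_cst partition_function) b.
congr sphere_bounded; apply/funext => m.
by rewrite equilibriumE invfM invrK expRN mulrC.
Qed.

Lemma frame_moment k l i j :
  \int[area]_m (h m * (frame k m * frame l m * (frame i m * frame j m))) =
  (\int[area]_m (latitude_weight eta m *
     (m ord0 k * m ord0 l * (m ord0 i * m ord0 j)))) / partition_function.
Proof.
rewrite -(Rintegral_reflection (nu - e0) (bounded_quartic eta k l i j)).
rewrite -RintegralZr//; last first.
  exact: integrable_bounded (bounded_reflection _ (bounded_quartic eta k l i j)).
by apply: eq_Rintegral => m _; rewrite equilibriumE /frame; ring.
Qed.

Definition quad (S : 'M[R]_n.+1) (m : 'rV[R]_n.+1) : R :=
  \sum_k \sum_l S k l * (frame k m * frame l m).

Definition moment_mx (f : 'rV[R]_n.+1 -> R) : 'M[R]_n.+1 :=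
  \matrix_(k, l) \int[area]_m (frame k m * frame l m * f m).

Lemma bounded_frame2 k l : sphere_bounded (fun m => frame k m * frame l m).
Proof. by apply: boundedM; exact: bounded_frame. Qed.

Lemma bounded_quad S : sphere_bounded (quad S).
Proof.
apply: bounded_sum => k; apply: bounded_sum => l.
by apply: boundedM; [exact: bounded_cst|exact: bounded_frame2].
Qed.

Lemma moment_mx_quad f S : sphere_integrable f ->
  \int[area]_m (f m * quad S m) = frobenius S (moment_mx f).
Proof.
move=> fi.
have fi2 k l : sphere_integrable (fun m => S k l * (frame k m * frame l m * f m)).
  by apply: integrable_scale; apply: integrable_bounded_mul => //; exact: bounded_frame2.
transitivity (\int[area]_m (\sum_k \sum_l (S k l * (frame k m * frame l m * f m)))).
  apply: eq_Rintegral => m _; rewrite mulr_sumr; apply: eq_bigr => k _.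
  by rewrite mulr_sumr; apply: eq_bigr => l _; ring.
rewrite Rintegral_sum//; last by move=> k; exact: (integrable_Rsum measurableT _ (fi2 k)).
apply: eq_bigr => k _; rewrite Rintegral_sum//; last by move=> l; exact: fi2.
apply: eq_bigr => l _.
rewrite mxE RintegralZl//; apply: integrable_bounded_mul => //; exact: bounded_frame2.
Qed.

Lemma moment_mx_sym f k l : moment_mx f k l = moment_mx f l k.
Proof. by rewrite !mxE; apply: eq_Rintegral => m _; rewrite (mulrC (frame k m)). Qed.

Lemma moment_mxB f g : sphere_integrable f -> sphere_integrable g ->
  moment_mx (fun m => f m - g m) = moment_mx f - moment_mx g.
Proof.
move=> fi gi; apply/matrixP => k l; rewrite !mxE -RintegralB//.
- by apply: eq_Rintegral => m _; rewrite mulrBr.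
- by apply: integrable_bounded_mul => //; exact: bounded_frame2.
- by apply: integrable_bounded_mul => //; exact: bounded_frame2.
Qed.

Lemma moment_mx_trace f : sphere_integrable f -> \tr (moment_mx f) = \int[area]_m f m.
Proof.
move=> fi; have mf := integrable_measurable fi.
have i2 k : sphere_integrable (fun m => frame k m * frame k m * f m).
  by apply: integrable_bounded_mul => //; exact: bounded_frame2.
transitivity (\sum_k \int[area]_m (frame k m * frame k m * f m)).
  by apply: eq_bigr => k _; rewrite mxE.
rewrite -Rintegral_sum//; apply: eq_sphere_Rintegral => //.
- exact: integrable_measurable (integrable_Rsum measurableT _ i2).
- move=> m Sm; rewrite -mulr_suml -[RHS]mul1r -(frame_sphere Sm); congr (_ * _).
Qed.

(** The second moments of a quadratic form in m under the equilibrium. Mixed and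
    transverse matrices are eigenvectors, and axial matrices go to axial ones. *)
Definition covariance S := moment_mx (fun m => h m * quad S m).

Definition frame_pair_moment (k l : 'I_n.+1) : R := pair_moment eta k l / partition_function.

Lemma covarianceE S k l : covariance S k l =
  \sum_i \sum_j S i j * \int[area]_m (h m * (frame k m * frame l m * (frame i m * frame j m))).
Proof.
have b i j : sphere_bounded (fun m => h m * (frame k m * frame l m * (frame i m * frame j m))).
  apply: boundedM; first exact: equilibrium_bounded.
  by apply: boundedM; exact: bounded_frame2.
have i2 i j : sphere_integrable (fun m => S i j * (h m * (frame k m * frame l m * (frame i m * frame j m)))).
  by apply: integrable_scale; exact: integrable_bounded.
rewrite mxE; transitivity (\int[area]_m (\sum_i \sum_j
   (S i j * (h m * (frame k m * frame l m * (frame i m * frame j m)))))).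
  apply: eq_Rintegral => m _; rewrite mulr_sumr mulr_sumr; apply: eq_bigr => i _.
  by rewrite mulr_sumr mulr_sumr; apply: eq_bigr => j _; ring.
rewrite Rintegral_sum//; last by move=> i; exact: (integrable_Rsum measurableT _ (i2 i)).
apply: eq_bigr => i _; rewrite Rintegral_sum//; last by move=> j; exact: i2.
apply: eq_bigr => j _.
by rewrite RintegralZl//; exact: integrable_bounded.
Qed.

Lemma covariance_offdiag S k l : k != l ->
  covariance S k l = (S k l + S l k) * frame_pair_moment k l.
Proof.
move=> kl; rewrite covarianceE.
have E i j : S i j * \int[area]_m (h m * (frame k m * frame l m * (frame i m * frame j m))) =
  S i j * ((i == k) && (j == l) || (i == l) && (j == k))%:R * frame_pair_moment k l.
  by rewrite frame_moment quartic_offdiag// /frame_pair_moment -!mulrA.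
under eq_bigr => i _ do under eq_bigr => j _ do rewrite E.
under eq_bigr => i _ do rewrite -mulr_suml.
rewrite -mulr_suml; congr (_ * _).
have lk : l != k by rewrite eq_sym.
rewrite (bigD1 k)//= [X in _ + X](bigD1 l)//= [X in _ + (_ + X)]big1 ?addr0; last first.
  move=> i /andP[ik il]; apply: big1 => j _.
  by rewrite (negbTE ik) (negbTE il)/= mulr0.
congr (_ + _).
- rewrite (bigD1 l)//= !eqxx/= mulr1 big1 ?addr0// => j jl.
  by rewrite ?eqxx (negbTE jl) ?(negbTE kl)/= mulr0.
- rewrite (bigD1 k)//= !eqxx (negbTE lk)/= mulr1 big1 ?addr0// => j jk.
  by rewrite ?eqxx (negbTE jk) ?(negbTE lk)/= mulr0.
Qed.

Lemma covariance_diag S k : covariance S k k = \sum_i S i i * frame_pair_moment k i.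
Proof.
rewrite covarianceE; apply: eq_bigr => i _.
rewrite (bigD1 i)//= frame_moment quartic_diag eqxx mul1r big1 ?addr0// => j ji.
by rewrite frame_moment quartic_diag eq_sym (negbTE ji) mul0r mul0r mulr0.
Qed.

Let A := J 1 / J 0.
Let c4 := J 2 / J 0.
Definition mixed_eigenvalue : R := (J 1 - J 2) / J 0 / n%:R.
Definition transverse_eigenvalue : R :=
  (J 0 - 2 * J 1 + J 2) / J 0 / (n%:R * (n%:R + 2)).
Local Notation d := mixed_eigenvalue.
Local Notation b := transverse_eigenvalue.

Let n0 : n%:R != 0 :> R.
Proof. by rewrite pnatr_eq0 -lt0n ltnW. Qed.

Let n20 : n%:R + 2 != 0 :> R.
Proof. by rewrite -natrD pnatr_eq0 addn2. Qed.

Let C0 : sphere_scale n != 0 :> R.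
Proof. by rewrite gt_eqF// sphere_scale_gt0. Qed.

Let J00 : J 0 != 0.
Proof. by rewrite gt_eqF// mass_gt0. Qed.

Lemma frame_pair_momentC k l : frame_pair_moment k l = frame_pair_moment l k.
Proof. by rewrite /frame_pair_moment pair_momentC. Qed.

Lemma frame_pair_moment00 : frame_pair_moment ord0 ord0 = c4.
Proof. by rewrite /frame_pair_moment pair_moment00// /partition_function /c4; field; rewrite C0 J00. Qed.

Lemma frame_pair_moment0 k : k != ord0 -> frame_pair_moment ord0 k = d.
Proof.
move=> k0; rewrite /frame_pair_moment pair_moment0// /partition_function /d; field.
by rewrite C0 J00 n0.
Qed.

Lemma frame_pair_moment_tangent k l : k != ord0 -> l != ord0 -> frame_pair_moment k l = (if k == l then 3 else 1) * b.
Proof.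
move=> k0 l0; rewrite /frame_pair_moment pair_moment_tangent// /tangent_moment /partition_function /b.
by case: ifP => _; field; rewrite C0 J00 n0 n20.
Qed.

Lemma covariance_mixed (T : 'M[R]_n.+1) : (forall k l, T k l = T l k) -> is_mixed T ->
  covariance T = (2 * d) *: T.
Proof.
move=> symT hT; apply/matrixP => k l; rewrite [RHS]mxE.
have [<-|kl] := eqVneq k l.
  by rewrite covariance_diag hT// mulr0 big1// => i _; rewrite hT// mul0r.
rewrite covariance_offdiag// (symT l k).
have [kl0|kl0] := eqVneq (k == ord0) (l == ord0); first by rewrite hT// addr0 mul0r mulr0.
suff -> : frame_pair_moment k l = d by ring.
have [k0|k0] := eqVneq k ord0.
  by rewrite k0 frame_pair_moment0//; move: kl0; rewrite k0 eqxx; case: (l == ord0).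
have [l0|l0] := eqVneq l ord0; first by rewrite l0 frame_pair_momentC frame_pair_moment0.
by move: kl0; rewrite (negbTE k0) (negbTE l0).
Qed.

Lemma covariance_transverse (T : 'M[R]_n.+1) : (forall k l, T k l = T l k) -> is_transverse T ->
  covariance T = (2 * b) *: T.
Proof.
move=> symT [hT trT]; apply/matrixP => k l; rewrite [RHS]mxE.
have [<-|kl] := eqVneq k l; last first.
  rewrite covariance_offdiag// (symT l k).
  have [k0|k0] := eqVneq k ord0; first by rewrite hT ?k0 ?eqxx// addr0 mul0r mulr0.
  have [l0|l0] := eqVneq l ord0; first by rewrite hT ?l0 ?eqxx ?orbT// addr0 mul0r mulr0.
  by rewrite frame_pair_moment_tangent// (negbTE kl); ring.
rewrite covariance_diag (bigD1 ord0)//= hT ?eqxx// mul0r add0r.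
have [->|k0] := eqVneq k ord0.
  rewrite hT ?eqxx// mulr0 (eq_bigr (fun i => T i i * d)); last first.
    by move=> i i0; rewrite frame_pair_moment0.
  by rewrite -mulr_suml trT mul0r.
rewrite (eq_bigr (fun i => T i i * b + (i == k)%:R * (2 * b * T i i))); last first.
  move=> i i0; rewrite frame_pair_moment_tangent// eq_sym; case: (i == k) => /=; ring.
rewrite big_split/= -mulr_suml trT mul0r add0r.
rewrite (bigD1 k)//= eqxx mul1r big1 ?addr0// => i /andP[_ ik].
by rewrite (negbTE ik) mul0r.
Qed.

(** On the sphere, with A the mean of s, the quadratic form of
    axial_mx (1 - A) (- A) is s - A: this is why the variance of s appears. *)
Lemma covariance_axial : covariance (axial_mx n (1 - A) (- A)) =
  (c4 - A ^+ 2) *: axial_mx n 1 (- n%:R^-1).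
Proof.
apply/matrixP => k l; rewrite [RHS]mxE.
have [<-|kl] := eqVneq k l; last first.
  by rewrite covariance_offdiag// !mxE (eq_sym l) (negbTE kl) !mul0r addr0 mul0r mulr0.
rewrite covariance_diag (bigD1 ord0)//= !mxE !eqxx !mul1r.
have E i : i != ord0 -> axial_mx n (1 - A) (- A) i i = - A.
  by move=> i0; rewrite mxE eqxx mul1r (negbTE i0).
have dE : d * n%:R = A - c4.
  by rewrite /d /A /c4; field; rewrite J00 n0.
have bE : b * (n%:R * (n%:R + 2)) = 1 - 2 * A + c4.
  by rewrite /b /A /c4; field; rewrite J00 n0 n20.
have [->|k0] := eqVneq k ord0.
  rewrite frame_pair_moment00 (eq_bigr (fun=> - A * d)); last by move=> i i0; rewrite E// frame_pair_moment0.
  rewrite sumr_const card_tangent -[_ *+ n]mulr_natr -mulrA dE; ring.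
rewrite frame_pair_momentC frame_pair_moment0// (eq_bigr (fun i => - A * b + (i == k)%:R * (- A * (2 * b)))); last first.
  move=> i i0; rewrite E// frame_pair_moment_tangent// eq_sym; case: (i == k) => /=; ring.
rewrite big_split/= sumr_const card_tangent (bigD1 k)//= eqxx mul1r big1 ?addr0; last first.
  by move=> i /andP[_ ik]; rewrite (negbTE ik) mul0r.
rewrite ?(negbTE k0) -[_ *+ n]mulr_natr; apply: (mulIf n0).
transitivity (- (c4 - A ^+ 2)); last by field.
transitivity ((1 - A) * (d * n%:R) - A * (b * (n%:R * (n%:R + 2)))); first ring.
rewrite dE bE; ring.
Qed.
End second_moments.

(** * Coercivity of the second variation *)

Section spectral_gap.
Context {R : realType}.
Variables (n : nat) (eta : R).
Hypothesis n2 : (2 <= n)%N.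
Hypothesis eta0 : 0 < eta.
Hypothesis supercritical :
  n.+1%:R * order_variance n.+1 eta < 2 * order_gap n.+1 eta.
Local Notation J p := (angular_moment n.+1 p eta).
Local Notation alpha := (sigma1 n.+1 eta).
Local Notation d := (mixed_eigenvalue n eta).
Local Notation b := (transverse_eigenvalue n eta).
Local Notation V := (order_variance n.+1 eta).

Let n3 : (3 <= n.+1)%N. Proof. by []. Qed.

Let nr0 : 0 < n%:R :> R.
Proof. by rewrite ltr0n ltnW. Qed.

Let gap0 : 0 < order_gap n.+1 eta.
Proof. by rewrite divr_gt0 ?moment_s_onem_gt0 ?mass_gt0. Qed.

Lemma alphaE : alpha = n%:R / (2 * order_gap n.+1 eta).
Proof. by rewrite sigma1E// -natr1 addrK. Qed.

Lemma alpha_gt0 : 0 < alpha.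
Proof. by rewrite alphaE divr_gt0// mulr_gt0. Qed.

Lemma mixed_eigenvalue_gt0 : 0 < d.
Proof. by rewrite /mixed_eigenvalue divr_gt0// divr_gt0 ?moment_s_onem_gt0 ?mass_gt0. Qed.

Lemma transverse_eigenvalue_gt0 : 0 < b.
Proof.
apply: divr_gt0; last by rewrite mulr_gt0// addr_gt0.
by apply: divr_gt0; [exact: moment_onem2_gt0|exact: mass_gt0].
Qed.

(** The choice alpha = sigma1 eta says exactly that the mixed directions are
    neutral: this is the tangent space to the orbit of rotations. *)
Lemma alpha_mixed : alpha * (2 * d) = 1.
Proof.
rewrite alphaE /mixed_eigenvalue -/(order_gap n.+1 eta).
by field; rewrite !gt_eqF.
Qed.

Lemma alpha_axial : alpha * (1 + n%:R^-1) * V < 1.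
Proof.
have -> : alpha * (1 + n%:R^-1) * V =
    (n.+1%:R * V) / (2 * order_gap n.+1 eta).
  by rewrite alphaE -natr1; field; rewrite !gt_eqF.
by rewrite ltr_pdivrMr ?mul1r// mulr_gt0.
Qed.

(** Subtracting the recursions for k = 0 and k = 1 leaves
    <(1-s)^2> - (n+2) <s (1-s)> = - 2 eta <s (1-s)^2>, negative since eta > 0. *)
Lemma alpha_transverse : alpha * (2 * b) < 1.
Proof.
have J0 := mass_gt0 n.+1 eta; have J12 := moment_s_onem_gt0 n.+1 eta.
have n20 : 0 < n%:R + 2 :> R by rewrite addr_gt0.
have -> : alpha * (2 * b) =
    (J 0 - 2 * J 1 + J 2) / ((n%:R + 2) * (J 1 - J 2)).
  by rewrite alphaE /transverse_eigenvalue /order_gap; field; rewrite !gt_eqF.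
rewrite ltr_pdivrMr ?mul1r ?mulr_gt0//.
have h0 := angular_moment_rec 0 eta (ltnW n3).
have h1 := angular_moment_rec 1 eta (ltnW n3).
have := mulr_gt0 eta0 (moment_s_onem2_gt0 n.+1 eta).
by rewrite -natr1 in h0 h1; lra.
Qed.

Definition gap_constant : R :=
  Num.min (1 - alpha * (1 + n%:R^-1) * V) (1 - alpha * (2 * b)).

Lemma gap_constant_gt0 : 0 < gap_constant.
Proof. by rewrite lt_min !subr_gt0 alpha_axial alpha_transverse. Qed.

Lemma gap_constant_le1 : gap_constant <= 1.
Proof.
rewrite ge_min; apply/orP; right; rewrite gerBl mulr_ge0 ?ltW ?alpha_gt0//.
by rewrite mulr_gt0// transverse_eigenvalue_gt0.
Qed.

Section at_director.
Variable nu : 'rV[R]_n.+1.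
Hypothesis nu1 : sphere n.+1 nu.
Local Notation area := (@sphere_measure R n.+1).
Local Notation h := (equilibrium eta nu).
Local Notation M := (moment_mx nu).
Local Notation A := (order_mean n.+1 eta).
Implicit Types f : 'rV[R]_n.+1 -> R.

Let hVb : sphere_bounded (fun m => (h m)^-1) := equilibriumV_bounded eta n2 nu1.
Let h0 m : h m != 0.
Proof. by rewrite gt_eqF// equilibrium_gt0. Qed.

Definition energy f : R := \int[area]_m (f m ^+ 2 / h m).

Lemma energy_integrable f : sphere_integrable (fun m => f m ^+ 2) ->
  sphere_integrable (fun m => f m ^+ 2 / h m).
Proof.
move=> f2; have := integrable_bounded_mul hVb f2.
by congr sphere_integrable; apply/funext => m; rewrite mulrC.
Qed.

Lemma bounded_hquad S : sphere_bounded (fun m => h m * quad nu S m).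
Proof. by apply: boundedM; [exact: equilibrium_bounded|exact: bounded_quad]. Qed.

Lemma energy_sub f S : measurable_fun setT f -> sphere_integrable (fun m => f m ^+ 2) ->
  energy (fun m => f m - h m * quad nu S m) =
  energy f - 2 * frobenius S (M f) + frobenius S (covariance eta nu S).
Proof.
move=> mf f2; have fi := square_integrable mf f2.
have i1 := energy_integrable f2.
have i2 : sphere_integrable (fun m => f m * quad nu S m).
  have := integrable_bounded_mul (bounded_quad nu S) fi.
  by congr sphere_integrable; apply/funext => m; rewrite mulrC.
have i3 : sphere_integrable (fun m => h m * quad nu S m * quad nu S m).
  by apply: integrable_bounded; apply: boundedM; [exact: bounded_hquad|exact: bounded_quad].
rewrite -(moment_mx_quad nu S fi) -(moment_mx_quad nu S (integrable_bounded (bounded_hquad S))).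
rewrite -RintegralZl// -RintegralB//; last exact: integrable_scale.
rewrite -RintegralD//; last by apply: integrable_sub => //; exact: integrable_scale.
apply: eq_Rintegral => m _; by field.
Qed.

(** Since h * quad S has the same second moments as f, it is the orthogonal
    projection of f for the weight h^-1, and its energy is the left-hand side. *)
Lemma second_moment_bessel f S : measurable_fun setT f ->
  sphere_integrable (fun m => f m ^+ 2) -> covariance eta nu S = M f ->
  frobenius S (M f) <= energy f.
Proof.
move=> mf f2 SE; have := energy_sub S mf f2; rewrite SE => E.
have : 0 <= energy (fun m => f m - h m * quad nu S m).
  apply: Rintegral_ge0 => m _; rewrite mulr_ge0 ?sqr_ge0// invr_ge0 ltW//.
  exact: equilibrium_gt0.
by rewrite E; lra.
Qed.

Lemma covarianceD S T : covariance eta nu (S + T) = covariance eta nu S + covariance eta nu T.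
Proof.
apply/matrixP => k l; rewrite [RHS]mxE !covarianceE// -big_split; apply: eq_bigr => i _.
by rewrite -big_split; apply: eq_bigr => j _; rewrite mxE mulrDl.
Qed.

Lemma covarianceZ c S : covariance eta nu (c *: S) = c *: covariance eta nu S.
Proof.
apply/matrixP => k l; rewrite [RHS]mxE !covarianceE// mulr_sumr; apply: eq_bigr => i _.
by rewrite mulr_sumr; apply: eq_bigr => j _; rewrite mxE mulrA.
Qed.

Definition tangent_component f : 'M[R]_n.+1 := (2 * d)^-1 *: mixed_part (M f).

(** Removes from f the element of the tangent space that has the same mixed second
    moments. This is an orthogonal projection for the weight h^-1, not for the
    inner product of L^2. *)
Definition residual f m := f m - h m * quad nu (tangent_component f) m.

Lemma tangent_component_mixed f : is_mixed (tangent_component f).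
Proof. by apply: mixedZ; exact: mixed_part_mixed. Qed.

Lemma tangent_component_sym f k l : tangent_component f k l = tangent_component f l k.
Proof.
rewrite [LHS]mxE [RHS]mxE; congr (_ * _); rewrite [LHS]mxE [RHS]mxE.
by rewrite (eq_sym (k == ord0)) moment_mx_sym.
Qed.

Lemma bounded_square f : sphere_bounded f -> sphere_integrable (fun m => f m ^+ 2).
Proof. by move=> fb; apply: integrable_bounded; exact: boundedX. Qed.

Lemma residual_square f : measurable_fun setT f -> sphere_integrable (fun m => f m ^+ 2) ->
  sphere_integrable (fun m => residual f m ^+ 2).
Proof.
move=> mf f2; have fi := square_integrable mf f2.
have bT := bounded_hquad (tangent_component f).
have b2 := boundedM (bounded_cst (-2)) bT.
have := integrable_add (integrable_add f2 (integrable_bounded_mul b2 fi)) (bounded_square bT).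
congr sphere_integrable; apply/funext => m; rewrite /residual; ring.
Qed.

(** Since alpha * (2 * d) = 1, removing the tangent component does not change the
    quadratic form. The second moments of the residual are axial plus
    transverse, where alpha times the eigenvalue is less than 1, so the Bessel
    inequality leaves a fixed fraction of the energy. *)
Lemma energy_residual f : measurable_fun setT f ->
  sphere_integrable (fun m => f m ^+ 2) -> \int[area]_m f m = 0 ->
  gap_constant * energy (residual f) <= energy f - alpha * frobenius (M f) (M f).
Proof.
move=> mf f2 f0; have fi := square_integrable mf f2.
have d0 := mixed_eigenvalue_gt0; have b0 := transverse_eigenvalue_gt0.
have V0 : 0 < V by exact: order_variance_gt0.
set T := tangent_component f; set T' := mixed_part (M f); set N := transverse_part (M f).
set p := M f ord0 ord0.
have hT' : is_mixed T' by exact: mixed_part_mixed.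
have hN : is_transverse N.
  by apply: transverse_part_transverse; [exact: ltnW|rewrite moment_mx_trace].
have ME : M f = axial_mx n p (- (p / n%:R)) + T' + N.
  by rewrite {1}(axial_decomposition (M f)) axialZ mulr1 mulrN.
have hT : is_mixed T by exact: tangent_component_mixed.
have covT : covariance eta nu T = T'.
  rewrite covariance_mixed//; last exact: tangent_component_sym.
  by rewrite scalerA divff ?scale1r// mulf_neq0// gt_eqF.
have zT : is_transverse (0 : 'M[R]_n.+1).
  by split=> [k l _|]; [rewrite mxE|rewrite big1// => k _; rewrite mxE].
have zM : is_mixed (0 : 'M[R]_n.+1) by move=> k l _; rewrite mxE.
have fro0 (S : 'M[R]_n.+1) : frobenius 0 S = 0.
  by apply: big1 => k _; apply: big1 => l _; rewrite mxE mul0r.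
have TM : frobenius T (M f) = frobenius T T'.
  rewrite ME !frobeniusDr (frobeniusC T (axial_mx _ _ _)) frobenius_axial_mixed// add0r.
  by rewrite (frobenius_mixed_transverse hT hN) addr0.
have TT : frobenius T T' = alpha * frobenius T' T'.
  have dn0 : 2 * d != 0 by rewrite gt_eqF// mulr_gt0.
  by rewrite frobeniusZl; congr (_ * _); apply: (mulIf dn0); rewrite mulVf// alpha_mixed.
have E1 : energy (residual f) = energy f - alpha * frobenius T' T'.
  by rewrite energy_sub// covT TM TT; lra.
have MM : frobenius (M f) (M f) = p ^+ 2 * (1 + n%:R^-1) + frobenius T' T' + frobenius N N.
  rewrite {1 2}ME frobenius_decomposition//; congr (_ + _ + _).
  by field; rewrite gt_eqF.
have bT := bounded_hquad T.
have Mr : M (residual f) = axial_mx n p (- (p / n%:R)) + 0 + N.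
  rewrite moment_mxB//; last exact: integrable_bounded.
  by rewrite -/(covariance eta nu T) covT {1}ME addr0 addrAC addrK.
(* Each part of the moments of the residual, divided by its eigenvalue. *)
pose S := axial_mx n (p / V * (1 - A)) (p / V * - A) + 0 + (2 * b)^-1 *: N.
have hS : covariance eta nu S = M (residual f).
  rewrite Mr /S !addr0 covarianceD -axialZ !covarianceZ covariance_axial//.
  rewrite covariance_transverse//; last first.
    move=> k l; rewrite /N [LHS]mxE [RHS]mxE orbC (eq_sym k l).
    by rewrite (moment_mx_sym nu f k l).
  rewrite -/V scalerA divfK ?gt_eqF// axialZ mulr1 mulrN.
  by rewrite scalerA mulVf ?scale1r// mulf_neq0// gt_eqF.
have mr : measurable_fun setT (residual f).
  by apply: measurable_funB => //; case: bT.
have r2 := residual_square mf f2.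
have := second_moment_bessel mr r2 hS.
rewrite Mr /S frobenius_decomposition//; last exact: transverseZ.
rewrite fro0 addr0 frobeniusZl => bes.
have {bes} bes : p ^+ 2 / V + frobenius N N / (2 * b) <= energy (residual f).
  apply: le_trans bes; rewrite le_eqVlt; apply/orP; left; apply/eqP.
  by rewrite [frobenius N N / _]mulrC; congr (_ + _); field; rewrite !gt_eqF.
rewrite MM; have -> : energy f = energy (residual f) + alpha * frobenius T' T'.
  by rewrite E1 subrK.
set Y := energy (residual f) in bes *.
have k1 : gap_constant <= 1 - alpha * (1 + n%:R^-1) * V by rewrite ge_min lexx.
have k2 : gap_constant <= 1 - alpha * (2 * b) by rewrite ge_min lexx orbT.
have k3 := gap_constant_le1.
move: (gap_constant) k1 k2 k3 => k k1 k2 k3.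
have e1 : alpha * (1 + n%:R^-1) * p ^+ 2 <= (1 - k) * (p ^+ 2 / V).
  have -> : alpha * (1 + n%:R^-1) * p ^+ 2 = (alpha * (1 + n%:R^-1) * V) * (p ^+ 2 / V).
    by field; rewrite !gt_eqF.
  have pV : 0 <= p ^+ 2 / V by rewrite divr_ge0 ?sqr_ge0// ltW.
  by rewrite ler_wpM2r//; lra.
have e2 : alpha * frobenius N N <= (1 - k) * (frobenius N N / (2 * b)).
  have -> : alpha * frobenius N N = (alpha * (2 * b)) * (frobenius N N / (2 * b)).
    by field; rewrite !gt_eqF.
  have Nb : 0 <= frobenius N N / (2 * b).
    by rewrite divr_ge0 ?frobenius_ge0// mulr_ge0// ltW.
  by rewrite ler_wpM2r//; lra.
have e3 : (1 - k) * (p ^+ 2 / V + frobenius N N / (2 * b)) <= (1 - k) * Y.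
  by rewrite ler_wpM2l// subr_ge0.
by lra.
Qed.

Lemma uncentered_variationE f m : sphere_integrable f ->
  uncentered_variation alpha h f m = f m / h m - alpha * quad nu (M f) m.
Proof.
move=> fi; rewrite /uncentered_variation; congr (_ - _ * _).
have i2 k l : sphere_integrable (fun m' => frame nu k m * frame nu l m * (frame nu k m' * frame nu l m' * f m')).
  by apply: integrable_scale; apply: integrable_bounded_mul => //; exact: bounded_frame2.
transitivity (\int[area]_m' (\sum_k \sum_l (frame nu k m * frame nu l m * (frame nu k m' * frame nu l m' * f m')))).
  apply: eq_Rintegral => m' _; rewrite (frame_dot nu) expr2 mulr_suml mulr_suml.
  apply: eq_bigr => k _; rewrite mulr_sumr mulr_suml; apply: eq_bigr => l _; ring.
rewrite Rintegral_sum//; last by move=> k; exact: (integrable_Rsum measurableT _ (i2 k)).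
apply: eq_bigr => k _; rewrite Rintegral_sum//; last by move=> l; exact: i2.
apply: eq_bigr => l _; rewrite RintegralZl//; last first.
  by apply: integrable_bounded_mul => //; exact: bounded_frame2.
by rewrite [M f k l]mxE mulrC.
Qed.

Lemma inner_second_variation f : measurable_fun setT f ->
  sphere_integrable (fun m => f m ^+ 2) -> \int[area]_m f m = 0 ->
  inner_L2 (second_variation alpha h f) f = energy f - alpha * frobenius (M f) (M f).
Proof.
move=> mf f2 f0; have fi := square_integrable mf f2.
have i1 := energy_integrable f2.
have i2 : sphere_integrable (fun m => f m * quad nu (M f) m).
  have := integrable_bounded_mul (bounded_quad nu (M f)) fi.
  by congr sphere_integrable; apply/funext => m; rewrite mulrC.
set c := (fine (area setT))^-1 * \int[area]_m uncentered_variation alpha h f m.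
transitivity (\int[area]_m (f m ^+ 2 / h m - alpha * (f m * quad nu (M f) m) - c * f m)).
  apply: eq_Rintegral => m _; rewrite /second_variation -/c uncentered_variationE//; ring.
rewrite RintegralB//; last 2 first.
- by apply: integrable_sub => //; exact: integrable_scale.
- exact: integrable_scale.
rewrite RintegralB//; last exact: integrable_scale.
by rewrite !RintegralZl// f0 mulr0 subr0 moment_mx_quad.
Qed.

(** The matrix of the quadratic form that multiplies h in the elements of the
    tangent space (quad_tangent_mx). *)
Definition tangent_mx (u : 'rV[R]_n.+1) : 'M[R]_n.+1 :=
  \matrix_(k, l) (if (k == ord0) == (l == ord0) then 0
                  else if k == ord0 then frame nu l u / 2 else frame nu k u / 2).

Lemma tangent_mx_mixed u : is_mixed (tangent_mx u).
Proof. by move=> k l kl; rewrite mxE kl eqxx. Qed.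

Lemma tangent_mx_sym u k l : tangent_mx u k l = tangent_mx u l k.
Proof.
by rewrite !mxE; case: (k == ord0); case: (l == ord0).
Qed.

Lemma quad_tangent_mx u m :
  quad nu (tangent_mx u) m = dot u (m - dot m nu *: nu) * dot m nu.
Proof.
have F i : frame nu i nu = (i == ord0)%:R.
  by rewrite /frame reflection_swap ?(frame_norm nu1)// mxE eqxx.
have -> : dot u (m - dot m nu *: nu) = \sum_(i | i != ord0) frame nu i u * frame nu i m.
  rewrite dotBr dotZr (frame_dot nu u m) (frame_dot nu u nu).
  rewrite (bigD1 ord0)//= [\sum_i frame nu i u * frame nu i nu](bigD1 ord0)//=.
  rewrite [X in _ - _ * (_ + X)]big1; last by move=> i i0; rewrite F (negbTE i0) mulr0.
  by rewrite F eqxx/= !(frame0 nu1); ring.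
have row k : k != ord0 -> \sum_l tangent_mx u k l * (frame nu k m * frame nu l m) =
    frame nu k u * frame nu k m * dot m nu / 2.
  move=> k0; rewrite (bigD1 ord0)//= big1 ?addr0; last first.
    by move=> l l0; rewrite mxE (negbTE k0) (negbTE l0) eqxx mul0r.
  by rewrite mxE (negbTE k0) eqxx/= (frame0 nu1); field.
rewrite /quad (bigD1 ord0)//= (eq_bigr _ row) -mulr_suml.
have -> : \sum_l tangent_mx u ord0 l * (frame nu ord0 m * frame nu l m) =
   \sum_(l | l != ord0) frame nu l u * frame nu l m * dot m nu / 2.
  rewrite (bigD1 ord0)//= mxE !eqxx mul0r add0r; apply: eq_bigr => l l0.
  by rewrite mxE (negbTE l0) eqxx/= (frame0 nu1); field.
by rewrite -!mulr_suml; field.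
Qed.

Lemma mixed_tangent_mx T : is_mixed T -> (forall k l, T k l = T l k) ->
  exists u, T = tangent_mx u.
Proof.
move=> hT symT; exists (reflection (nu - delta_mx ord0 ord0) (\row_i (2 * T ord0 i))).
apply/matrixP => k l; rewrite mxE /frame reflectionK !mxE.
case: eqP => [kl|/eqP kl]; first by rewrite hT.
have [->|k0] := eqVneq k ord0; first by field.
have -> : l = ord0 by apply/eqP; move: kl; rewrite (negbTE k0); case: (l == _).
by rewrite symT; field.
Qed.

Lemma equilibrium_le m : sphere n.+1 m -> h m <= expR eta / partition_function n eta.
Proof.
move=> Sm; rewrite equilibriumE// ler_pM2r ?invr_gt0 ?partition_function_gt0//.
rewrite ler_expR -[leRHS]mulr1 ler_pM2l// -/(frame nu ord0 m).
rewrite -(frame_sphere nu Sm) (bigD1 ord0)//= lerDl.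
by apply: sumr_ge0 => i _; exact: sqr_ge0.
Qed.

Definition coercivity_constant : R :=
  gap_constant * (partition_function n eta / expR eta).

Lemma energy_ge f : sphere_integrable (fun m => f m ^+ 2) ->
  partition_function n eta / expR eta * \int[area]_m (f m ^+ 2) <= energy f.
Proof.
move=> f2; have i1 := energy_integrable f2.
rewrite -RintegralZl// /energy Rintegral_sphere; last exact: integrable_scale.
rewrite [leRHS]Rintegral_sphere//.
have mS := @measurable_sphere R n.+1.
apply: le_Rintegral => //.
- by apply/sphere_integrableP; [exact: integrable_measurable (integrable_scale _ f2)|exact: integrable_scale].
- by apply/sphere_integrableP; [exact: integrable_measurable i1|].
move=> m Sm; rewrite mulrC ler_wpM2l ?sqr_ge0//.
rewrite -invf_div lef_pV2 ?posrE; first exact: equilibrium_le.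
- by rewrite divr_gt0 ?expR_gt0 ?partition_function_gt0.
- exact: equilibrium_gt0.
Qed.

Lemma quadZ c S m : quad nu (c *: S) m = c * quad nu S m.
Proof.
rewrite /quad mulr_sumr; apply: eq_bigr => k _; rewrite mulr_sumr.
by apply: eq_bigr => l _; rewrite mxE -mulrA.
Qed.

Lemma measurable_uncentered f : sphere_integrable f ->
  measurable_fun setT (uncentered_variation alpha h f).
Proof.
move=> fi; have mf := integrable_measurable fi; have [mV _] := hVb.
have [mq _] := bounded_quad nu (M f).
apply: (eq_measurable_fun (fun m => f m / h m - alpha * quad nu (M f) m)).
  by move=> m _; rewrite uncentered_variationE.
apply: measurable_funB; first exact: measurable_funM.
by apply: measurable_funM.
Qed.

Lemma tangent_space_quad u :
  tangent_space eta nu (fun m => h m * quad nu (tangent_mx u) m).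
Proof.
split.
  by apply/Lfun2P; split; [case: (bounded_hquad (tangent_mx u))|exact: bounded_square (bounded_hquad _)].
exists u; apply: ae_eq_sphere => m _; rewrite quad_tangent_mx; ring.
Qed.

(** On the kernel the quadratic form vanishes, so the residual has zero energy and
    only the tangent component remains. Conversely, the covariance multiplies a
    mixed matrix by 2 * d, and alpha * (2 * d) = 1 cancels the two terms. *)
Lemma kernel_second_variation :
  ker_second_variation alpha h = tangent_space eta nu.
Proof.
apply/seteqP; split => f.
  move=> [[fL f0] fker]; split=> //; have [mf f2] := (Lfun2P f).1 fL.
  have fi := square_integrable mf f2.
  have i0 : inner_L2 (second_variation alpha h f) f = 0.
    transitivity (\int[area]_m (0 : R)); last by rewrite Rintegral_cst// mul0r.
    apply: eq_ae_Rintegral => //.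
      by apply: measurable_funM => //; apply: measurable_funB => //; exact: measurable_uncentered.
    by apply: filterS fker => m k /k ->; rewrite mul0r.
  have := energy_residual mf f2 f0; rewrite -inner_second_variation// i0.
  rewrite pmulr_rle0 ?gap_constant_gt0// => e0.
  have r2 := residual_square mf f2.
  have := le_trans (energy_ge r2) e0.
  rewrite pmulr_rle0 ?divr_gt0 ?partition_function_gt0 ?expR_gt0// => r0.
  have mr : measurable_fun setT (residual f).
    by apply: measurable_funB => //; case: (bounded_hquad (tangent_component f)).
  have [u uE] := mixed_tangent_mx (tangent_component_mixed f) (tangent_component_sym f).
  exists u; apply: filterS (Rintegral_sqr_eq0 r2 mr r0) => m k /k /eqP.
  by rewrite subr_eq0 uE quad_tangent_mx mulrC => /eqP.
move=> [fL [u fu]]; have [mf f2] := (Lfun2P f).1 fL.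
have fi := square_integrable mf f2.
have bT := bounded_hquad (tangent_mx u).
have Mf : M f = (2 * d) *: tangent_mx u.
  rewrite -(covariance_mixed eta n2 nu1); [|exact: tangent_mx_sym|exact: tangent_mx_mixed].
  apply/matrixP => k l; rewrite [LHS]mxE [RHS]mxE; apply: eq_ae_Rintegral.
  - by apply: measurable_funM => //; case: (bounded_frame2 nu k l).
  - by apply: measurable_funM; [case: (bounded_frame2 nu k l)|case: bT].
  - by apply: filterS fu => m e /e ->; rewrite quad_tangent_mx (mulrC (h m)).
have f0 : \int[area]_m f m = 0.
  rewrite -(moment_mx_trace nu fi) Mf /mxtrace big1// => k _.
  by rewrite mxE tangent_mx_mixed// mulr0.
have u0 : uncentered_variation alpha h f = cst 0 %[ae area].
  apply: filterS fu => m e /e fE.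
  rewrite uncentered_variationE// Mf quadZ mulrA alpha_mixed mul1r fE quad_tangent_mx.
  by rewrite mulfK// subrr.
split; first by split.
have I0 : \int[area]_m uncentered_variation alpha h f m = 0.
  transitivity (\int[area]_m (0 : R)); last by rewrite Rintegral_cst// mul0r.
  by apply: eq_ae_Rintegral => //; exact: measurable_uncentered.
by apply: filterS u0 => m e /e; rewrite /second_variation I0 mulr0 subr0.
Qed.

(** The residual differs from psi by an element of the tangent space, to which psi
    is orthogonal in L^2; so the residual is at least as long as psi. *)
Lemma coercivity psi : tangent_perp eta nu psi ->
  coercivity_constant * norm_L2 psi ^+ 2 <= inner_L2 (second_variation alpha h psi) psi.
Proof.
move=> [[pL p0] perp]; have [mp p2] := (Lfun2P psi).1 pL.
have pi := square_integrable mp p2.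
rewrite inner_second_variation// norm_L2_sqr//.
apply: le_trans (energy_residual mp p2 p0).
rewrite /coercivity_constant -mulrA ler_pM2l ?gap_constant_gt0//.
have r2 := residual_square mp p2.
apply: le_trans (energy_ge r2).
rewrite ler_pM2l ?divr_gt0 ?partition_function_gt0 ?expR_gt0//.
have [u uE] := mixed_tangent_mx (tangent_component_mixed psi) (tangent_component_sym psi).
have bT := bounded_hquad (tangent_component psi).
have orth : \int[area]_m (h m * quad nu (tangent_component psi) m * psi m) = 0.
  have := perp _ (tangent_space_quad u); rewrite -uE => <-.
  by apply: eq_Rintegral => m _; rewrite mulrC.
have i1 := integrable_bounded_mul bT pi.
have i2 := bounded_square bT.
have -> : \int[area]_m (residual psi m ^+ 2) = \int[area]_m (psi m ^+ 2) +
    \int[area]_m ((h m * quad nu (tangent_component psi) m) ^+ 2).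
  transitivity (\int[area]_m (psi m ^+ 2 + (h m * quad nu (tangent_component psi) m) ^+ 2 -
     2 * (h m * quad nu (tangent_component psi) m * psi m))).
    apply: eq_Rintegral => m _; rewrite /residual; ring.
  rewrite RintegralB//; last 2 first.
  - exact: integrable_add.
  - exact: integrable_scale.
  by rewrite RintegralD// RintegralZl// orth mulr0 subr0.
by rewrite lerDl; apply: Rintegral_ge0 => m _; exact: sqr_ge0.
Qed.
End at_director.
End spectral_gap.

Theorem theorem1p2 (R : realType) (n : nat) (eta eta1 : R) (hn : (3 <= n)%N)
    (eta1_min : forall eta' : R, sigma1 n eta1 <= sigma1 n eta')
    (eta1_lt : eta1 < eta) :
  let alpha := sigma1 n eta in
  (forall nu : 'rV[R]_n, sphere n nu ->
     ker_second_variation alpha (equilibrium eta nu) = tangent_space eta nu) /\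
  exists2 c0 : R, 0 < c0 &
    forall nu : 'rV[R]_n, sphere n nu ->
    forall psi : 'rV[R]_n -> R, tangent_perp eta nu psi ->
      c0 * norm_L2 psi ^+ 2
        <= inner_L2 (second_variation alpha (equilibrium eta nu) psi) psi.
Proof.
case: n hn eta1_min => [//|n] n3 eta1_min alpha.
have [eta0 super] := supercritical_conditions n3 eta1_min eta1_lt.
split; first by move=> nu; exact: kernel_second_variation.
exists (coercivity_constant n eta).
  by rewrite mulr_gt0 ?gap_constant_gt0// divr_gt0 ?partition_function_gt0 ?expR_gt0.
by move=> nu nu1 psi; exact: coercivity.
Qed.
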